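(* (1) Suppose $1 \leq p \leq\infty$ and $p\neq 2$. Then every isometric Schur multiplier on $S_p$ is defined by a matrix of the form $[a_ib_j]_{i,j\in\mathbb{N}}$ with $a_i,b_j \in \mathbb{T}$. (2) Suppose $1 \leq p < \infty$. The space $\mathfrak{M}_{p}$ of bounded Schur multipliers on $S_p$ is the closure of the linear span of the isometric Schur multipliers on $S_p$ in the weak operator topology.
   Context: $\mathbb{T}=\{z\in\mathbb{C}: |z|=1\}$. For $1\le p<\infty$, $S_p$ is the Schatten class of compact operators $A$ on $\ell_2^{\mathbb{N}}$ with $\|A\|_{S_p}=(\mathrm{Tr}\,(A^*A)^{p/2})^{1/p}<\infty$; $S_\infty$ is the space of compact operators on $\ell_2^{\mathbb{N}}$ with the operator norm. Elements are regarded as $\mathbb{N}\times\mathbb{N}$ matrices. $*$ is the Schur (entrywise) product $[a_{ij}]*[b_{ij}]=[a_{ij}b_{ij}]$. A matrix $A$ defines a Schur multiplier $M_A$ on $S_p$ if $M_A(B)=A*B\in S_p$ for all $B\in S_p$ (then $M_A$ is bounded); it is isometric if $\|M_A(B)\|_{S_p}=\|B\|_{S_p}$ for all $B\in S_p$. $\mathfrak{M}_p\subset B(S_p)$ is the space of all bounded Schur multipliers on $S_p$. The weak operator topology and closure in (2) are those of $B(S_p)$. *)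

(* Defs.v *)
From HB Require Import structures.
From mathcomp Require Import all_boot all_order all_algebra.
From mathcomp Require Import all_classical all_reals all_analysis.
From mathcomp Require Import complex.
Set Implicit Arguments.
Unset Strict Implicit.
Unset Printing Implicit Defensive.
Import Order.TTheory GRing.Theory Num.Theory.
Import numFieldNormedType.Exports.
Local Open Scope classical_set_scope.
Local Open Scope ring_scope.
Local Open Scope complex_scope.

Section Ell2.
Context {R : realType}.
Local Notation C := R[i].
Local Notation normc := (@Normc.normc R).
Implicit Types x y : nat -> C.

Definition ell2_norm x : \bar R :=
  Lnorm counting 2%:E (fun n => (normc (x n))%:E).

Definition ell2_pred : {pred nat -> C} := fun x => (ell2_norm x < +oo)%E.

Lemma normc_ge0 (c : C) : 0 <= normc c.
Proof. by case: c => a b; exact: sqrtr_ge0. Qed.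

Lemma ell2_normZ (c : C) x :
  ell2_norm (c *: x) = ((normc c)%:E * ell2_norm x)%E.
Proof.
rewrite /ell2_norm !Lnorm_counting//.
under eq_eseriesr => k _ do
  rewrite /= Normc.normcM normrM (ger0_norm (normc_ge0 c))
    powRM ?normc_ge0// EFinM.
rewrite nneseriesZl; last by move=> n _; rewrite lee_fin powR_ge0.
rewrite poweRM ?lee_fin ?powR_ge0//; last first.
  by apply: nneseries_ge0 => n _ _; rewrite lee_fin powR_ge0.
by rewrite poweR_EFin -powRrM divff ?powRr1 ?normc_ge0// pnatr_eq0.
Qed.

Lemma ell2_normD x y : (ell2_norm (x + y)%R <= ell2_norm x + ell2_norm y)%E.
Proof.
apply: (@le_trans _ _ (Lnorm counting 2%:E (EFin \o
   ((fun n => normc (x n)) \+ (fun n => normc (y n)))))).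
  rewrite /ell2_norm !Lnorm_counting//; apply: gt0_ler_poweR.
  - by rewrite invr_ge0.
  - by rewrite in_itv/= leey andbT nneseries_ge0// => n _ _; rewrite lee_fin powR_ge0.
  - by rewrite in_itv/= leey andbT nneseries_ge0// => n _ _; rewrite lee_fin powR_ge0.
  - apply: lee_nneseries => [n _ _|n _]; first by rewrite lee_fin powR_ge0.
    rewrite lee_fin; apply: ge0_ler_powR; rewrite ?nnegrE//=.
    rewrite !ger0_norm ?addr_ge0 ?normc_ge0//.
    exact: le_normcD.
apply: minkowski_EFin => //; by rewrite ler1n.
Qed.

Lemma ell2_norm_ge0 x : (0 <= ell2_norm x)%E.
Proof. exact: Lnorm_ge0. Qed.

Lemma ell2_norm0_eq0 x : ell2_norm x = 0%E -> x = 0.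
Proof.
rewrite /ell2_norm Lnorm_counting// => /poweR_eq0_eq0 x0.
apply/funext => n; apply: Normc.eq0_normc.
have p0 k : (0 <= (`|normc (x k)| `^ 2)%:E)%E by rewrite lee_fin powR_ge0.
have /eqP := x0 (nneseries_ge0 (fun k _ _ => p0 k)).
rewrite (nneseriesD1 (n := n)) => [|k _|//]; last exact: p0.
rewrite padde_eq0; [|exact: p0|by apply: nneseries_ge0 => k _ _; exact: p0].
by move=> /andP[/eqP[/powR_eq0_eq0/normr0_eq0]].
Qed.

Definition basis_seq (n : nat) : nat -> C := fun k => (k == n)%:R.

Lemma basis_seqP n : basis_seq n \in ell2_pred.
Proof.
rewrite unfold_in /ell2_pred /ell2_norm Lnorm_counting// poweR_lty//.
rewrite (nneseriesD1 (n := n))//; last by move=> k _; rewrite lee_fin powR_ge0.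
rewrite eseries0 ?adde0 ?ltry// => k _ kn.
by rewrite /basis_seq (negbTE kn) Normc.normc0 /= normr0 powR0.
Qed.

Lemma ell2_submod_closed : submod_closed ell2_pred.
Proof.
split=> [|c x y].
  have -> : (0 : nat -> C) = 0 *: 0 by rewrite scale0r.
  by rewrite /ell2_pred unfold_in ell2_normZ Normc.normc0 mul0e.
rewrite /ell2_pred !unfold_in => hx hy; apply: le_lt_trans (ell2_normD _ _) _.
by rewrite lte_add_pinfty// ell2_normZ lte_mul_pinfty// lee_fin normc_ge0.
Qed.

HB.instance Definition _ :=
  GRing.isSubmodClosed.Build C (nat -> C) ell2_pred ell2_submod_closed.

End Ell2.

Record ell2 (R : realType) :=
  Ell2 { ell2_val :> nat -> R[i] ; _ : ell2_val \in @ell2_pred R }.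
HB.instance Definition _ R := [isSub for @ell2_val R].
HB.instance Definition _ R := [Choice of ell2 R by <:].
HB.instance Definition _ R := [SubChoice_isSubLmodule of ell2 R by <:].

Section Ell2Norm.
Context {R : realType}.
Local Notation C := R[i].
Local Notation normc := (@Normc.normc R).
Implicit Types x y : ell2 R.

Definition norm2 x : R := fine (ell2_norm x).

Let ell2_fin x : ell2_norm x \is a fin_num.
Proof. by rewrite ge0_fin_numE ?ell2_norm_ge0//; case: x => x; exact. Qed.

Let norm2D x y : (norm2 (x + y))%:C <= (norm2 x)%:C + (norm2 y)%:C.
Proof.
rewrite -rmorphD/= lecR -lee_fin EFinD /norm2 !fineK//.
exact: ell2_normD.
Qed.

Let norm2Z (c : C) x : (norm2 (c *: x))%:C = `|c| * (norm2 x)%:C.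
Proof.
by rewrite /norm2 ell2_normZ fineM//= rmorphM.
Qed.

Let norm2_eq0 x : (norm2 x)%:C = 0 -> x = 0.
Proof.
move=> -[x0]; apply/val_inj/ell2_norm0_eq0.
by rewrite -(fineK (ell2_fin x)) -[fine _]/(norm2 x) x0.
Qed.

HB.instance Definition _ :=
  Lmodule_isNormed.Build (Num.NumField.clone C _) (ell2 R) norm2D norm2Z norm2_eq0.

End Ell2Norm.

Section Schatten.
Context {R : realType}.
Local Notation C := R[i].
Local Notation H := (ell2 R).

Definition basis_vec (n : nat) : H := Ell2 (basis_seqP n).

Definition inner (x y : H) : C^o :=
  limn (series (fun n => (x n * (y n)^* : C^o))).

Definition compact_operator (T : H -> H) :=
  linear T /\ precompact (T @` [set x | `|x| <= 1]).

Definition operator_norm (T : H -> H) : \bar R :=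
  ereal_sup [set (norm2 (T x))%:E | x in [set x | norm2 x <= 1]].

Definition adjoint (T : H -> H) : H -> H :=
  xget (fun=> 0) [set S | forall x y, inner (T x) y = inner x (S y)].

(* Functional calculus for a compact positive operator P and r > 0: as P is
   diagonalizable in an orthonormal basis, P^r is the unique bounded operator
   acting as lambda^r on the lambda-eigenvectors of P. *)
Definition operator_power (P : H -> H) (r : R) : H -> H :=
  xget (fun=> 0) [set Q | [/\ linear Q, continuous Q &
    forall (lambda : R) v, 0 <= lambda ->
      P v = lambda%:C *: v -> Q v = (lambda `^ r)%:C *: v]].

(* Only meaningful for positive operators, whose diagonal entries are >= 0. *)
Definition trace (P : H -> H) : \bar R :=
  (\sum_(n <oo) (complex.Re (inner (P (basis_vec n)) (basis_vec n)))%:E)%E.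

Definition schatten_norm (p : \bar R) (T : H -> H) : \bar R :=
  if p is r%:E then
    (trace (operator_power (adjoint T \o T) (r / 2)) `^ r^-1)%E
  else operator_norm T.

Definition schatten (p : \bar R) : set (H -> H) :=
  [set T | compact_operator T /\ (schatten_norm p T < +oo)%E].

Definition matrix_of (T : H -> H) : nat -> nat -> C :=
  fun i j => T (basis_vec j) i.

Definition schur (A B : nat -> nat -> C) : nat -> nat -> C :=
  fun i j => A i j * B i j.

Section Multipliers.
Variable p : \bar R.
Local Notation Sp := (set_type (schatten p)).

(* M is the map M_A : S_p -> S_p; such an M exists iff A * B is in S_p for all
   B in S_p. *)
Definition schur_multiplier (A : nat -> nat -> C) (M : Sp -> Sp) :=
  forall T, matrix_of (val (M T)) = schur A (matrix_of (val T)).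

Definition isometric (M : Sp -> Sp) :=
  forall T, schatten_norm p (val (M T)) = schatten_norm p (val T).

(* S_p is a linear subspace of the space of operators; this is linearity for
   the induced operations, phrased so as not to depend on a proof of this. *)
Definition schatten_linear (V : lmodType C) (f : Sp -> V) :=
  forall (c : C) (S T U : Sp),
    val U = c *: val S + val T -> f U = c *: f S + f T.

Definition schatten_dual : set (Sp -> C^o) :=
  [set phi | schatten_linear phi /\ exists c : R, forall T,
    ((Normc.normc (phi T))%:E <= c%:E * schatten_norm p (val T))%E].

Definition bounded_op : set (Sp -> Sp) :=
  [set M | schatten_linear (fun T => val (M T)) /\ exists c : R, forall T,
    (schatten_norm p (val (M T)) <= c%:E * schatten_norm p (val T))%E].

Definition wot_eval (M : set_type bounded_op) :
    {ptws (set_type schatten_dual * Sp)%type -> C^o} :=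
  fun q => val q.1 (val M q.2).

(* B(S_p) with the weak operator topology *)
Definition wot := initial_topology wot_eval.

Definition schur_multipliers : set wot :=
  [set M | exists A, schur_multiplier A (val M)].

Definition isometric_schur_multipliers : set wot :=
  [set M | schur_multipliers M /\ isometric (val M)].

Definition linear_span (X : set wot) : set wot :=
  [set M | exists (n : nat) (c : 'I_n -> C) (F : 'I_n -> wot),
    (forall k, X (F k)) /\
    forall T, val (val M T) = \sum_(k < n) c k *: val (val (F k) T)].

End Multipliers.
End Schatten.

Arguments schur_multiplier {R} p A M.
Arguments isometric {R} p M.
Arguments schur_multipliers {R} p.
Arguments isometric_schur_multipliers {R} p.
Arguments linear_span {R} p X.

(* Main.v *)
(** (1) Testing an isometric multiplier on matrix units shows that its entries are
    unimodular.  A 2 x 2 block of ones has a single nonzero singular value, 2, and its image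
    has the same Hilbert-Schmidt norm; as [p <> 2], preservation of the [S_p] norm forces
    the image to have rank one as well, so all 2 x 2 minors of the symbol vanish.

    (2) Entries are bounded functionals on [S_p], so being a Schur multiplier is a closed
    condition for the weak operator topology.  Conversely, the corner [P_n (M T) P_n] of a
    multiplier lies in the span, since the indicator of an index is a combination of two
    unimodular sequences, and [phi (P_n X P_n)] converges to [phi X] for every bounded
    functional [phi]: peel off the leading singular vectors of [X] one at a time; the
    remainder has small [S_p] norm, and the claim is elementary for rank one operators.

    Both parts rest on the formula [||T||_p ^ p = \sum_k l_k ^ (p / 2)], where [l_k] are the
    eigenvalues of [T^* T].  The eigenvectors are produced by repeated deflation, and
    [(T^* T) ^ r] is [V^* D V] with [V] the partial isometry of coefficients in the
    eigenvectors and [D] diagonal. *)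
Require Import Defs.
From mathcomp Require Import all_boot all_order all_algebra.
From mathcomp Require Import all_classical all_reals all_analysis.
From mathcomp Require Import complex ring lra.
Import Order.TTheory GRing.Theory Num.Theory.
Import numFieldNormedType.Exports.
Local Open Scope classical_set_scope.
Local Open Scope ring_scope.
Local Open Scope complex_scope.
Set Implicit Arguments.
Unset Strict Implicit.
Unset Printing Implicit Defensive.

(** Two obstacles shape the proof. [adjoint] and [operator_power] are choices made by [xget], so a
    norm can be computed only after existence and uniqueness are settled; for the power, a bounded
    operator is pinned down by its values on the right singular vectors and on the kernel of [T].
    The resulting norm formula holds for every system satisfying [svd]. Hence explicit systems serve
    for rank one operators, two-column operators and unimodular changes of phase, and deflation is
    needed only for abstract compact operators. The triangle inequality in [S_p] is never
    established. Sums are formed only where membership in [S_p] is known independently (finite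
    range, rank one, deflation), and estimates are made on the scalars [phi X] instead of on norms
    of sums. The exclusion of [p = 2] enters as follows: the squared singular values of a unimodular
    2 x 2 block sum to 4, and for positive [x], [y] with [x + y = 1] the sum of the powers with
    exponent [q = p / 2] differs from 1 as soon as [q] is not 1. For infinite [p] the largest
    singular value alone decides. *)

Section ComplexLimits.
Context {R : realType}.
Local Notation C := R[i].
Local Notation normc := (@Normc.normc R).
Implicit Types (z w : C).

Lemma realCM (a b : R) : (a * b)%:C = a%:C * b%:C :> C.
Proof. exact: rmorphM. Qed.

Lemma realCD (a b : R) : (a + b)%:C = a%:C + b%:C :> C.
Proof. exact: rmorphD. Qed.

Lemma realCN (a : R) : (- a)%:C = - a%:C :> C.
Proof. exact: rmorphN. Qed.

Lemma conj_realM (a : R) z : conjc (a%:C * z) = a%:C * conjc z.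
Proof. by rewrite rmorphM; congr (_ * _); exact: conjc_real. Qed.

Lemma normE z : `|z| = (normc z)%:C.
Proof. by case: z. Qed.

Lemma normc_sqr z : normc z ^+ 2 = complex.Re z ^+ 2 + complex.Im z ^+ 2.
Proof. by case: z => a b; rewrite /= sqr_sqrtr// addr_ge0// sqr_ge0. Qed.

Lemma mulc_conj z : z * conjc z = (normc z ^+ 2)%:C.
Proof. by rewrite rmorphXn /= -normE sqr_normc. Qed.

Lemma normc_conj z : normc (conjc z) = normc z.
Proof. by case: z => a b /=; rewrite sqrrN. Qed.

Lemma normc_real (a : R) : normc a%:C = `|a|.
Proof. by rewrite /= expr0n /= addr0 sqrtr_sqr. Qed.

Lemma normc_Re z : `|complex.Re z| <= normc z.
Proof.
case: z => a b /=; rewrite -sqrtr_sqr ler_wsqrtr// lerDl; exact: sqr_ge0.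
Qed.

Lemma normc_Im z : `|complex.Im z| <= normc z.
Proof.
case: z => a b /=; rewrite -[`|b|]sqrtr_sqr ler_wsqrtr// lerDr; exact: sqr_ge0.
Qed.

Lemma normc_le z : normc z <= `|complex.Re z| + `|complex.Im z|.
Proof.
rewrite -(@ler_pXn2r _ 2) ?nnegrE ?addr_ge0 ?normc_ge0//.
rewrite normc_sqr sqrrD !real_normK ?num_real//.
by rewrite addrAC lerDl mulrn_wge0// mulr_ge0.
Qed.

Lemma normc_distC z w : normc (z - w) = normc (w - z).
Proof. by rewrite -opprB normcN. Qed.

Lemma normc_eq0 z : (normc z == 0) = (z == 0).
Proof.
apply/eqP/eqP => [/Normc.eq0_normc //|->]; exact: Normc.normc0.
Qed.

Lemma complex_cvg (z : nat -> C) (a b : R) :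
  (fun n => complex.Re (z n)) @ \oo --> a -> (fun n => complex.Im (z n)) @ \oo --> b ->
  (z : nat -> C^o) @ \oo --> (a +i* b : C^o).
Proof.
(* In the partial order on complex numbers, [0 < e] says that [e] is real and positive, so its real
   part can be split in two. *)
move=> za zb; apply/cvgrPdist_lt => e; rewrite ltcE/= => /andP[/eqP ei0 e0].
have e20 : 0 < complex.Re e / 2 by rewrite divr_gt0.
move/cvgrPdist_lt : za => /(_ _ e20) za.
move/cvgrPdist_lt : zb => /(_ _ e20) zb.
near=> n.
rewrite normE ltcE /= ei0 eqxx /=; apply: (le_lt_trans (normc_le _)).
rewrite [ltRHS]splitr ltrD//.
- suff -> : complex.Re (a +i* b - z n) = a - complex.Re (z n) by near: n; exact: za.
  by rewrite /=; case: (z n).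
- suff -> : complex.Im (a +i* b - z n) = b - complex.Im (z n) by near: n; exact: zb.
  by rewrite /=; case: (z n).
Unshelve. all: by end_near. Qed.

Lemma cvg_normc (z : nat -> C) (l : C) :
  (z : nat -> C^o) @ \oo --> (l : C^o) <-> normc (z n - l) @[n --> \oo] --> (0 : R).
Proof.
split.
  move=> /cvgrPdist_lt h; apply/cvgrPdist_lt => e e0.
  have := h e%:C; rewrite ltcR => /(_ e0); apply: filterS => n.
  by rewrite normE ltcR sub0r normrN ger0_norm ?normc_ge0// normc_distC.
move=> /cvgrPdist_lt h; apply/cvgrPdist_lt => e.
rewrite ltcE/= => /andP[/eqP ei0 e0].
have := h _ e0; apply: filterS => n.
by rewrite sub0r normrN ger0_norm ?normc_ge0// normc_distC normE ltcE /= ei0 eqxx.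
Qed.

Lemma cvgC_unique (z : nat -> C) (a b : C) :
  normc (z n - a) @[n --> \oo] --> (0 : R) ->
  normc (z n - b) @[n --> \oo] --> (0 : R) -> a = b.
Proof.
move=> /(cvg_normc z a).2 za /(cvg_normc z b).2 zb.
exact: (cvg_unique (@norm_hausdorff _ C^o) za zb).
Qed.

Lemma Re_sum (I : Type) (r : seq I) (P : pred I) (F : I -> C) :
  complex.Re (\sum_(i <- r | P i) F i) = \sum_(i <- r | P i) complex.Re (F i).
Proof. by apply: big_morph => // -[a b] [c d]. Qed.

Lemma Im_sum (I : Type) (r : seq I) (P : pred I) (F : I -> C) :
  complex.Im (\sum_(i <- r | P i) F i) = \sum_(i <- r | P i) complex.Im (F i).
Proof. by apply: big_morph => // -[a b] [c d]. Qed.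

Lemma conjc_sum (I : Type) (r : seq I) (P : pred I) (F : I -> C) :
  conjc (\sum_(i <- r | P i) F i) = \sum_(i <- r | P i) conjc (F i).
Proof. exact: (rmorph_sum conjc). Qed.

Lemma cvg_nonneg_series (f : nat -> R) (B : R) : (forall n, 0 <= f n) ->
  (forall N, \sum_(0 <= i < N) f i <= B) -> cvgn (series f).
Proof.
move=> f0 fB; apply: nondecreasing_is_cvgn.
  by apply/nondecreasing_series => n _.
by exists B => _ [n _ <-]; exact: fB.
Qed.

Lemma cvg_abs_series (f g : nat -> R) (B : R) : (forall n, `|f n| <= g n) ->
  (forall N, \sum_(0 <= i < N) g i <= B) -> cvgn (series f).
Proof.
move=> fg gB; apply: normed_cvg; apply: (@cvg_nonneg_series (fun n => `|f n|) B) => [n|N]; first exact: normr_ge0.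
by apply: le_trans (gB N); apply: ler_sum => i _; exact: fg.
Qed.

Lemma complex_series_cvg (z : nat -> C) (g : nat -> R) (B : R) :
  (forall n, normc (z n) <= g n) -> (forall N, \sum_(0 <= i < N) g i <= B) ->
  cvgn (series (z : nat -> C^o)).
Proof.
move=> zg gB.
have h1 : cvgn (series (fun n => complex.Re (z n))).
  by apply: (@cvg_abs_series _ g B) => // n; apply: le_trans (zg n); exact: normc_Re.
have h2 : cvgn (series (fun n => complex.Im (z n))).
  by apply: (@cvg_abs_series _ g B) => // n; apply: le_trans (zg n); exact: normc_Im.
apply/cvg_ex; exists (limn (series (fun n => complex.Re (z n))) +i* limn (series (fun n => complex.Im (z n)))).
apply: complex_cvg.
- by rewrite (_ : (fun _ => _) = series (fun n => complex.Re (z n)))//; apply/funext => n; rewrite /= /series /= Re_sum.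
- by rewrite (_ : (fun _ => _) = series (fun n => complex.Im (z n)))//; apply/funext => n; rewrite /= /series /= Im_sum.
Qed.

End ComplexLimits.

(** * The inner product of l2 *)

Section Ell2Space.
Context {R : realType}.
Local Notation C := R[i].
Local Notation normc := (@Normc.normc R).
Local Notation H := (ell2 R).
Implicit Types (x y z : H) (c : C).

Lemma ell2D x y n : (x + y) n = x n + y n. Proof. by []. Qed.
Lemma ell2Z c x n : (c *: x) n = c * x n. Proof. by []. Qed.
Lemma ell2N x n : (- x) n = - x n. Proof. by []. Qed.
Lemma ell20 n : (0 : H) n = 0. Proof. by []. Qed.

Lemma ell2_sum (I : Type) (r : seq I) (P : pred I) (F : I -> H) n :
  (\sum_(i <- r | P i) F i) n = \sum_(i <- r | P i) F i n.
Proof. by apply: (big_morph (fun x : H => x n)). Qed.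

Lemma ell2_ext x y : (forall n, x n = y n) -> x = y.
Proof. by move=> h; apply/val_inj/funext. Qed.

Lemma norm2_ge0 x : 0 <= norm2 x.
Proof. by rewrite fine_ge0// ell2_norm_ge0. Qed.

Lemma ell2_normE (x : nat -> C) :
  ell2_norm x = ((\sum_(0 <= k <oo) (normc (x k) ^+ 2)%:E) `^ 2^-1)%E.
Proof.
rewrite /ell2_norm Lnorm_counting//; congr poweR.
apply: eq_eseriesr => k _ /=.
by rewrite ger0_norm ?normc_ge0// -powR_mulrn ?normc_ge0.
Qed.

Lemma ell2_nneseries x :
  (\sum_(0 <= k <oo) (normc (x k) ^+ 2)%:E)%E = (norm2 x ^+ 2)%:E.
Proof.
have h0 : (0 <= \sum_(0 <= k <oo) (normc (x k) ^+ 2)%:E)%E.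
  by apply: nneseries_ge0 => n _ _; rewrite lee_fin sqr_ge0.
have : (ell2_norm x < +oo)%E by case: x {h0} => x; exact.
rewrite /norm2 ell2_normE; move: h0.
case: (\sum_(0 <= k <oo) _)%E => [s||]//=.
  by rewrite lee_fin -powR_mulrn ?powR_ge0// -powRrM mulVf// => s0 _; rewrite powRr1.
(* An infinite sum has an infinite square root, against membership in the space. *)
by rewrite /poweR invr_eq0 pnatr_eq0.
Qed.

Lemma sumsq_cvg x :
  (fun N => \sum_(0 <= i < N) normc (x i) ^+ 2) @ \oo --> norm2 x ^+ 2.
Proof.
have := ell2_nneseries x.
set u := fun n => (\sum_(0 <= k < n) (normc (x k) ^+ 2)%:E)%E.
have : cvgn u by apply: is_cvg_nneseries => n _ _; rewrite lee_fin sqr_ge0.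
move=> cu e; have /fine_cvg : u @ \oo --> (norm2 x ^+ 2)%:E by rewrite -e.
rewrite (_ : fine \o u = (fun N => \sum_(0 <= i < N) normc (x i) ^+ 2))//.
by apply/funext => n; rewrite /u /= sumEFin.
Qed.

Lemma sumsq_le x N : \sum_(0 <= i < N) normc (x i) ^+ 2 <= norm2 x ^+ 2.
Proof.
rewrite -lee_fin -ell2_nneseries -sumEFin.
by apply: nneseries_lim_ge => n _ _; rewrite lee_fin sqr_ge0.
Qed.

Lemma coord_le x n : normc (x n) <= norm2 x.
Proof.
rewrite -(@ler_pXn2r _ 2) ?nnegrE ?norm2_ge0 ?normc_ge0//.
apply: le_trans (sumsq_le x n.+1); rewrite big_nat_recr//= lerDr.
by apply: sumr_ge0 => i _; exact: sqr_ge0.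
Qed.

Lemma ell2_mem (x : nat -> C) (B : R) :
  (forall N, \sum_(0 <= i < N) normc (x i) ^+ 2 <= B) -> x \in ell2_pred.
Proof.
move=> xB; rewrite unfold_in /ell2_pred ell2_normE poweR_lty//.
apply: (@le_lt_trans _ _ B%:E); last exact: ltry.
apply: lime_le.
  by apply: is_cvg_nneseries => n _ _; rewrite lee_fin sqr_ge0.
by apply: nearW => N; rewrite sumEFin lee_fin.
Qed.

Lemma norm2_le x (B : R) : 0 <= B ->
  (forall N, \sum_(0 <= i < N) normc (x i) ^+ 2 <= B ^+ 2) -> norm2 x <= B.
Proof.
move=> B0 xB; rewrite -(@ler_pXn2r _ 2) ?nnegrE ?norm2_ge0//.
rewrite -(cvg_lim (@Rhausdorff R) (@sumsq_cvg x)).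
by apply: limr_le; [exact: cvgP (@sumsq_cvg x)|exact: nearW xB].
Qed.

Lemma inner_series_cvg x y :
  (fun N => \sum_(0 <= i < N) (x i * conjc (y i))) @ \oo --> inner x y.
Proof.
have h : cvgn (series (fun n => (x n * conjc (y n) : C^o))).
  apply: (@complex_series_cvg _ _ (fun n => normc (x n) ^+ 2 + normc (y n) ^+ 2)
    (norm2 x ^+ 2 + norm2 y ^+ 2)).
    move=> n; rewrite Normc.normcM normc_conj.
    have a0 := normc_ge0 (x n); have b0 := normc_ge0 (y n); nra.
  by move=> N; rewrite big_split lerD// sumsq_le.
exact: h.
Qed.

Lemma inner_cvg x y :
  normc (\sum_(0 <= i < N) (x i * conjc (y i)) - inner x y) @[N --> \oo] --> (0 : R).
Proof. exact/cvg_normc/inner_series_cvg. Qed.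

Lemma innerDl x y z : inner (x + y) z = inner x z + inner y z.
Proof.
apply: (cvg_unique (@norm_hausdorff _ C^o) (@inner_series_cvg _ _)).
rewrite [X in X @ _](_ : _ = (fun N => \sum_(0 <= i < N) x i * conjc (z i) : C^o) +
    (fun N => \sum_(0 <= i < N) y i * conjc (z i) : C^o)).
  by apply: cvgD; exact: inner_series_cvg.
apply/funext => N; rewrite -[RHS]big_split.
by apply: eq_bigr => i _; rewrite ell2D mulrDl.
Qed.

Lemma innerZl c x y : inner (c *: x) y = c * inner x y.
Proof.
apply: (cvg_unique (@norm_hausdorff _ C^o) (@inner_series_cvg _ _)).
rewrite [X in X @ _](_ : _ = (fun N => c *: (\sum_(0 <= i < N) x i * conjc (y i) : C^o))).
  by apply: cvgZr; exact: inner_series_cvg.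
apply/funext => N; rewrite [RHS]mulr_sumr.
by apply: eq_bigr => i _; rewrite ell2Z mulrA.
Qed.

Lemma innerC x y : inner y x = conjc (inner x y).
Proof.
apply: (cvgC_unique (@inner_cvg y x)).
suff -> : (fun N => normc (\sum_(0 <= i < N) (y i * conjc (x i)) - conjc (inner x y))) =
  (fun N => normc (\sum_(0 <= i < N) (x i * conjc (y i)) - inner x y)) by exact: inner_cvg.
apply/funext => N; rewrite -[LHS]normc_conj rmorphB/= conjc_sum conjcK; congr (normc (_ - _)).
by apply: eq_bigr => i _; rewrite rmorphM /= conjcK mulrC.
Qed.

Lemma inner_norm x : inner x x = (norm2 x ^+ 2)%:C.
Proof.
apply: (cvg_unique (@norm_hausdorff _ C^o) (@inner_series_cvg _ _)).
apply: (@complex_cvg _ (fun N => \sum_(0 <= i < N) x i * conjc (x i))).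
  suff -> : (fun N => complex.Re (\sum_(0 <= i < N) x i * conjc (x i))) =
    (fun N => \sum_(0 <= i < N) normc (x i) ^+ 2) by exact: sumsq_cvg.
  by apply/funext => N; rewrite Re_sum; apply: eq_bigr => i _; rewrite mulc_conj.
rewrite (_ : (fun _ => _) = cst 0); first exact: cvg_cst.
by apply/funext => N; rewrite Im_sum big1// => i _; rewrite mulc_conj.
Qed.

Lemma innerDr x y z : inner x (y + z) = inner x y + inner x z.
Proof. by rewrite innerC innerDl rmorphD /= -!innerC. Qed.

Lemma innerZr c x y : inner x (c *: y) = conjc c * inner x y.
Proof. by rewrite innerC innerZl rmorphM /= -!innerC. Qed.

Lemma innerNl x y : inner (- x) y = - inner x y.
Proof. by rewrite -scaleN1r innerZl mulN1r. Qed.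

Lemma innerNr x y : inner x (- y) = - inner x y.
Proof. by rewrite innerC innerNl rmorphN /= -innerC. Qed.

Lemma innerBl x y z : inner (x - y) z = inner x z - inner y z.
Proof. by rewrite innerDl innerNl. Qed.

Lemma innerBr x y z : inner x (y - z) = inner x y - inner x z.
Proof. by rewrite innerDr innerNr. Qed.

Lemma inner0l x : inner 0 x = 0.
Proof. by rewrite -(scale0r 0) innerZl mul0r. Qed.

Lemma inner0r x : inner x 0 = 0.
Proof. by rewrite innerC inner0l conjc0. Qed.

Lemma inner_suml (I : Type) (r : seq I) (P : pred I) (F : I -> H) y :
  inner (\sum_(i <- r | P i) F i) y = \sum_(i <- r | P i) inner (F i) y.
Proof.
by apply: (big_morph (fun x => inner x y)) => [u v|]; rewrite ?innerDl ?inner0l.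
Qed.

Lemma inner_sumr (I : Type) (r : seq I) (P : pred I) (F : I -> H) y :
  inner y (\sum_(i <- r | P i) F i) = \sum_(i <- r | P i) inner y (F i).
Proof.
by apply: (big_morph (fun x => inner y x)) => [u v|]; rewrite ?innerDr ?inner0r.
Qed.

Lemma norm2_0 : norm2 (0 : H) = 0.
Proof.
have /(congr1 (@complex.Re R)) := inner_norm (0 : H); rewrite inner0l /=.
by move/esym/eqP; rewrite sqrf_eq0 => /eqP.
Qed.

Lemma norm2_eq0 x : norm2 x = 0 -> x = 0.
Proof.
by move=> x0; apply/ell2_ext => n; apply: Normc.eq0_normc; apply/eqP;
  rewrite eq_le normc_ge0 andbT -x0 coord_le.
Qed.

Lemma norm2Z c x : norm2 (c *: x) = normc c * norm2 x.
Proof. by rewrite /norm2 ell2_normZ fineM// ge0_fin_numE ?ell2_norm_ge0//; case: x. Qed.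

Lemma norm2N x : norm2 (- x) = norm2 x.
Proof. by rewrite -scaleN1r norm2Z normcN Normc.normc1 mul1r. Qed.

Lemma norm2_distC x y : norm2 (x - y) = norm2 (y - x).
Proof. by rewrite -opprB norm2N. Qed.

Lemma norm2D x y : norm2 (x + y) <= norm2 x + norm2 y.
Proof. by rewrite -lecR rmorphD /=; exact: (ler_normD x y). Qed.

Lemma norm2_normE x : `|x| = (norm2 x)%:C. Proof. by []. Qed.

Lemma sqr_norm2D x y : norm2 (x + y) ^+ 2 =
  norm2 x ^+ 2 + norm2 y ^+ 2 + 2 * complex.Re (inner x y).
Proof.
have /(congr1 (@complex.Re R)) := inner_norm (x + y).
rewrite innerDl !innerDr !inner_norm (innerC x y) /=.
by case: (inner x y) => a b /= <-; ring.
Qed.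

Lemma inner_self0 x : inner x x = 0 -> x = 0.
Proof.
rewrite inner_norm => /(congr1 (@complex.Re R)) /= /eqP; rewrite sqrf_eq0 => /eqP; exact: norm2_eq0.
Qed.

Lemma inner_ext x y : (forall z, inner z x = inner z y) -> x = y.
Proof.
move=> h; apply/eqP; rewrite -subr_eq0; apply/eqP/inner_self0.
by rewrite innerBr h subrr.
Qed.

(** The square norm of [|y|^2 x - <x, y> y] is nonnegative; this multiple of the usual residual
    keeps the expansion polynomial. *)
Lemma cauchy_schwarz x y : normc (inner x y) <= norm2 x * norm2 y.
Proof.
have [y0|ny0] := eqVneq (norm2 y) 0.
  by rewrite y0 mulr0 (norm2_eq0 y0) inner0r Normc.normc0.
have y0 : 0 < norm2 y by rewrite lt_neqAle eq_sym ny0 norm2_ge0.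
have y2 : 0 < norm2 y ^+ 2 by rewrite exprn_gt0.
pose a := inner x y.
have e : inner ((norm2 y ^+ 2)%:C *: x - a *: y) ((norm2 y ^+ 2)%:C *: x - a *: y)
  = (norm2 y ^+ 2 * (norm2 y ^+ 2 * norm2 x ^+ 2 - normc a ^+ 2))%:C.
  rewrite innerBl !innerBr !innerZl !innerZr (innerC x y) -/a !inner_norm.
  have aa : (normc a)%:C * (normc a)%:C = a * conjc a by rewrite mulc_conj -realCM.
  by rewrite conjc_real !(realCM, realCD, realCN) aa; ring.
have : 0 <= norm2 y ^+ 2 * (norm2 y ^+ 2 * norm2 x ^+ 2 - normc a ^+ 2).
  by move: e; rewrite inner_norm => /(congr1 (@complex.Re R)) /= <-; exact: sqr_ge0.
rewrite pmulr_rge0// subr_ge0 -exprMn mulrC.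
by rewrite ler_pXn2r ?nnegrE ?mulr_ge0 ?norm2_ge0 ?normc_ge0.
Qed.

End Ell2Space.

(** * Bounded operators, adjoints and diagonal operators *)

Section BoundedOperators.
Context {R : realType}.
Local Notation C := R[i].
Local Notation normc := (@Normc.normc R).
Local Notation H := (ell2 R).
Implicit Types (x y z : H) (c : C) (T S : H -> H).

Lemma basis_vecE n k : basis_vec n k = (k == n)%:R :> C.
Proof. by []. Qed.

Lemma inner_basisr x n : inner x (basis_vec n) = x n.
Proof.
apply/esym/(cvgC_unique (z := fun N => \sum_(0 <= i < N) x i * conjc (basis_vec n i)));
  last exact: inner_cvg.
apply: cvg_near_cst; exists n.+1 => // N /= nN.
rewrite (big_cat_nat (n := n))//=; last exact: ltnW.
rewrite (big_ltn nN) /basis_seq.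
rewrite eqxx conjc1 mulr1 !big_nat !big1 => [|i|i].
- by rewrite add0r addr0 subrr Normc.normc0.
- by move=> /andP[ni _]; rewrite gtn_eqF// conjc0 mulr0.
- by move=> ni; rewrite ltn_eqF// conjc0 mulr0.
Qed.

Lemma inner_basisl x n : inner (basis_vec n) x = conjc (x n).
Proof. by rewrite innerC inner_basisr. Qed.

Lemma norm2_basis n : norm2 (basis_vec n : H) = 1.
Proof.
have /(congr1 (@complex.Re R)) /= := inner_norm (basis_vec n : H).
rewrite inner_basisr basis_vecE eqxx /= => /esym/eqP.
by rewrite sqrp_eq1 ?norm2_ge0// => /eqP.
Qed.

Definition comb (a : nat -> C) N : H := \sum_(0 <= i < N) a i *: basis_vec i.

Lemma combE a N k : comb a N k = if (k < N)%N then a k else 0.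
Proof.
rewrite ell2_sum.
under eq_bigr do rewrite ell2Z basis_vecE.
case: ltnP => kN.
  rewrite (bigD1_seq k) ?mem_index_iota ?iota_uniq//= eqxx mulr1 big1 ?addr0//.
  by move=> i ik; rewrite eq_sym (negbTE ik) mulr0.
rewrite big_nat big1// => i /= iN.
by rewrite gtn_eqF ?mulr0// (leq_trans iN).
Qed.

Lemma norm2_comb a N : norm2 (comb a N) ^+ 2 = \sum_(0 <= i < N) normc (a i) ^+ 2.
Proof.
have /(congr1 (@complex.Re R)) /= <- := inner_norm (comb a N).
rewrite {1}/comb inner_suml Re_sum !big_nat; apply: eq_bigr => i /= iN.
by rewrite innerZl inner_basisl combE iN mulc_conj.
Qed.

Lemma comb_cvg x : norm2 (x - comb x N) @[N --> \oo] --> (0 : R).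
Proof.
have e N : norm2 (x - comb x N) ^+ 2 = norm2 x ^+ 2 - \sum_(0 <= i < N) normc (x i) ^+ 2.
  rewrite sqr_norm2D norm2N norm2_comb innerNr.
  suff -> : complex.Re (- inner x (comb x N)) = - \sum_(0 <= i < N) normc (x i) ^+ 2 by ring.
  rewrite /comb inner_sumr -sumrN Re_sum -sumrN; apply: eq_bigr => i _.
  by rewrite innerZr inner_basisr mulrC mulc_conj.
have h : norm2 (x - comb x N) ^+ 2 @[N --> \oo] --> (0 : R).
  rewrite (_ : (fun N => _) = (fun N => norm2 x ^+ 2 - \sum_(0 <= i < N) normc (x i) ^+ 2)).
    rewrite -[X in _ --> X](subrr (norm2 x ^+ 2)).
    by apply: cvgB; [exact: cvg_cst|exact: sumsq_cvg].
  exact/funext.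
apply/cvgrPdist_lt => e0 e00.
move/cvgrPdist_lt : h => /(_ (e0 ^+ 2)); rewrite exprn_gt0// => /(_ isT).
apply: filterS => N; rewrite !sub0r !normrN normrX !ger0_norm ?norm2_ge0//.
by rewrite ltr_pXn2r ?nnegrE ?norm2_ge0 ?(ltW e00).
Qed.

Definition blin T := linear T /\ exists c : R, forall x, norm2 (T x) <= c * norm2 x.

Lemma blin_linear T : blin T -> linear T. Proof. by case. Qed.

Lemma blin_bound T : blin T -> exists2 c : R, 0 < c & forall x, norm2 (T x) <= c * norm2 x.
Proof.
move=> [_ [c cT]]; exists (`|c| + 1); first by rewrite ltr_wpDl.
move=> x; apply: le_trans (cT x) _; rewrite ler_wpM2r ?norm2_ge0//.
by rewrite (le_trans (ler_norm c))// lerDl.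
Qed.

Section Linear.
Variable T : H -> H.
Hypothesis linT : linear T.

Lemma linopD x y : T (x + y) = T x + T y.
Proof. by have := linT 1 x y; rewrite !scale1r. Qed.

Lemma linop0 : T 0 = 0.
Proof. by have /eqP := linopD 0 0; rewrite addr0 -subr_eq subrr => /eqP/esym. Qed.

Lemma linopZ c x : T (c *: x) = c *: T x.
Proof. by have := linT c x 0; rewrite !addr0 linop0 addr0. Qed.

Lemma linopB x y : T (x - y) = T x - T y.
Proof. by rewrite linopD -scaleN1r linopZ scaleN1r. Qed.

Lemma linop_sum (I : Type) (r : seq I) (P : pred I) (F : I -> H) :
  T (\sum_(i <- r | P i) F i) = \sum_(i <- r | P i) T (F i).
Proof. by apply: big_morph; [exact: linopD|exact: linop0]. Qed.

End Linear.

Lemma blin_id : blin id.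
Proof. by split=> //; exists 1 => x; rewrite mul1r. Qed.

Lemma blin_comp T S : blin T -> blin S -> blin (T \o S).
Proof.
move=> bT bS; split.
  by move=> c x y /=; rewrite (blin_linear bS) (blin_linear bT).
have [c c0 cT] := blin_bound bT; have [d d0 dS] := blin_bound bS.
exists (c * d) => x /=; apply: le_trans (cT _) _.
by rewrite -mulrA ler_pM2l.
Qed.

Lemma blinD T S : blin T -> blin S -> blin (T + S).
Proof.
move=> [lT [c cT]] [lS [d dS]]; split.
  by move=> a x y; rewrite -[LHS]/(T _ + S _) lT lS scalerDr addrACA.
exists (c + d) => x; apply: le_trans (norm2D _ _) _.
by rewrite mulrDl lerD.
Qed.

Lemma blinZ c T : blin T -> blin (c *: T).
Proof.
move=> [lT [d dT]]; split.
  by move=> a x y; rewrite -[LHS]/(c *: T _) lT scalerDr !scalerA mulrC.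
exists (normc c * d) => x; rewrite -[(c *: T) x]/(c *: T x) norm2Z -mulrA.
by rewrite ler_wpM2l ?normc_ge0.
Qed.

Lemma blin0 : blin 0.
Proof.
by rewrite -(scale0r id); apply: blinZ; exact: blin_id.
Qed.

Lemma blin_sum (I : Type) (r : seq I) (P : pred I) (F : I -> H -> H) :
  (forall i, P i -> blin (F i)) -> blin (\sum_(i <- r | P i) F i).
Proof. by move=> bF; apply: big_ind => //; [exact: blin0|exact: blinD]. Qed.

Lemma blin_comb_cvg T x : blin T ->
  norm2 (T x - \sum_(0 <= i < N) x i *: T (basis_vec i)) @[N --> \oo] --> (0 : R).
Proof.
move=> bT; have [c c0 cT] := blin_bound bT; have lT := blin_linear bT.
apply: (@squeeze_cvgr _ _ _ _ (cst 0) (fun N => c * norm2 (x - comb x N))).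
- apply: nearW => N; rewrite norm2_ge0 /=.
  rewrite (_ : _ - _ = T (x - comb x N)); first exact: cT.
  by rewrite (linopB lT) (linop_sum lT); congr (_ - _); apply: eq_bigr => i _; rewrite (linopZ lT).
- exact: cvg_cst.
- by rewrite -(mulr0 c); apply: cvgMr; exact: comb_cvg.
Qed.

Lemma norm2_cvg_unique (s : nat -> H) x y :
  norm2 (x - s n) @[n --> \oo] --> (0 : R) ->
  norm2 (y - s n) @[n --> \oo] --> (0 : R) -> x = y.
Proof.
move=> sx sy; apply/eqP; rewrite -subr_eq0; apply/eqP/norm2_eq0/eqP.
rewrite eq_le norm2_ge0 andbT.
have h : norm2 (x - s n) + norm2 (y - s n) @[n --> \oo] --> (0 : R).
  by rewrite -(addr0 0); apply: cvgD.
rewrite -(cvg_lim (@Rhausdorff R) h); apply: limr_ge; first exact: cvgP h.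
apply: nearW => n; rewrite (_ : x - y = (x - s n) - (y - s n)); last first.
  by rewrite opprB addrA subrK.
by apply: le_trans (norm2D _ _) _; rewrite norm2N.
Qed.

Lemma blin_ext T S : blin T -> blin S ->
  (forall n, T (basis_vec n) = S (basis_vec n)) -> T = S.
Proof.
move=> bT bS h; apply/funext => x.
apply: (norm2_cvg_unique (blin_comb_cvg x bT)).
have := blin_comb_cvg x bS; rewrite (_ : (fun N => _ (S x - _)) =
  (fun N => norm2 (S x - \sum_(0 <= i < N) x i *: T (basis_vec i))))//.
by apply/funext => N; congr (norm2 (_ - _)); apply: eq_bigr => i _; rewrite h.
Qed.

Lemma blin_matrix_ext T S : blin T -> blin S -> matrix_of T = matrix_of S -> T = S.
Proof.
move=> bT bS h; apply: blin_ext => // n; apply: ell2_ext => k.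
by have := congr1 (fun A => A k n) h.
Qed.

Definition is_adjoint T S := forall x y, inner (T x) y = inner x (S y).

(** The coordinates of [S y] are forced. They are square summable because a finite section [z] of
    them satisfies [|z|^2 = <T z, y> <= c |z| |y|], which bounds [|z|] by [c |y|] whatever its
    length. *)
Lemma adjoint_exists T : blin T -> exists2 S, blin S & is_adjoint T S.
Proof.
move=> bT; have [c c0 cT] := blin_bound bT; have lT := blin_linear bT.
pose a y := fun j => conjc (inner (T (basis_vec j)) y).
have aB y N : \sum_(0 <= i < N) normc (a y i) ^+ 2 <= (c * norm2 y) ^+ 2.
  rewrite -norm2_comb; set z := comb _ _.
  rewrite ler_pXn2r ?nnegrE ?norm2_ge0 ?mulr_ge0 ?norm2_ge0 ?(ltW c0)//.
  have [z0|z0] := eqVneq (norm2 z) 0; first by rewrite z0 mulr_ge0 ?norm2_ge0 ?(ltW c0).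
  have zp : 0 < norm2 z by rewrite lt_neqAle eq_sym z0 norm2_ge0.
  rewrite -(ler_pM2l zp) -expr2.
  have -> : norm2 z ^+ 2 = normc (inner (T z) y).
    rewrite -[LHS]ger0_norm ?sqr_ge0// -normc_real norm2_comb; congr normc.
    rewrite /z /comb (linop_sum lT) inner_suml (rmorph_sum (real_complex R)).
    apply: eq_bigr => i _; rewrite (linopZ lT) innerZl /= -mulc_conj conjcK.
    by [].
  apply: le_trans (cauchy_schwarz _ _) _.
  by rewrite mulrA (mulrC _ c) ler_wpM2r ?norm2_ge0.
pose S y := Ell2 (ell2_mem (aB y)).
exists S.
  split=> [d x y|].
    apply: ell2_ext => n; rewrite ell2D ell2Z /= /a innerDr innerZr.
    by rewrite rmorphD rmorphM /= conjcK.
  exists c => y; apply: norm2_le; first by rewrite mulr_ge0 ?norm2_ge0 ?(ltW c0).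
  exact: aB.
move=> x y.
apply: (cvgC_unique (z := fun N => \sum_(0 <= i < N) (x i * conjc (S y i)))); last first.
  exact: inner_cvg.
apply: (@squeeze_cvgr _ _ _ _ (cst 0)
  (fun N => norm2 (T x - \sum_(0 <= i < N) x i *: T (basis_vec i)) * norm2 y)).
- apply: nearW => N; rewrite normc_ge0 /=.
  rewrite normc_distC (_ : _ - _ = inner (T x - \sum_(0 <= i < N) x i *: T (basis_vec i)) y).
    exact: cauchy_schwarz.
  rewrite innerBl inner_suml; congr (_ - _); apply: eq_bigr => i _.
  by rewrite innerZl /= /a conjcK.
- exact: cvg_cst.
- by rewrite -(mul0r (norm2 y)); apply: cvgMl; exact: blin_comb_cvg.
Qed.

Lemma is_adjoint_unique T S S' : is_adjoint T S -> is_adjoint T S' -> S = S'.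
Proof.
by move=> h h'; apply/funext => y; apply: inner_ext => x; rewrite -h -h'.
Qed.

Lemma adjointE T S : is_adjoint T S -> adjoint T = S.
Proof.
move=> h; apply: (is_adjoint_unique (T := T)) => //.
by rewrite /adjoint; case: xgetP => [S' _ //|/(_ S)].
Qed.

Lemma adjointP T : blin T -> blin (adjoint T) /\ is_adjoint T (adjoint T).
Proof. by move=> /adjoint_exists[S bS aS]; rewrite (adjointE aS). Qed.

Lemma ell2_nbhsP x (P : set H) :
  nbhs x P <-> exists2 e : R, 0 < e & forall y, norm2 (x - y) < e -> P y.
Proof.
split.
  move=> /nbhs_normP [e /=]; rewrite ltcE /= => /andP[/eqP ei0 e0] h.
  exists (complex.Re e) => // y xy; apply: h.
  by rewrite /= norm2_normE ltcE /= ei0 eqxx.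
move=> [e e0 h]; apply/nbhs_normP; exists e%:C; first by rewrite /= ltcR.
by move=> y /=; rewrite norm2_normE ltcR; exact: h.
Qed.

Lemma blin_continuous T : blin T -> linear T /\ continuous T.
Proof.
move=> bT; split; first exact: blin_linear.
have [c c0 cT] := blin_bound bT; have lT := blin_linear bT.
move=> x P /ell2_nbhsP [e e0 eP]; apply/ell2_nbhsP.
exists (e / c); first by rewrite divr_gt0.
move=> y xy; apply: eP; rewrite -(linopB lT); apply: le_lt_trans (cT _) _.
by rewrite mulrC -ltr_pdivlMr.
Qed.

(** [operator_power] constrains its operator by topological continuity, while extensionality on the
    basis works with norm bounds; this is the bridge. *)
Lemma continuous_blin T : linear T -> continuous T -> blin T.
Proof.
move=> lT cT; split=> //.
have : nbhs (T 0) [set y | norm2 (T 0 - y) < 1] by apply/ell2_nbhsP; exists 1.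
move=> /cT /ell2_nbhsP [d d0 h].
have {}h y : norm2 y < d -> norm2 (T y) < 1.
  move=> yd; have /= := h y; rewrite sub0r (linop0 lT) sub0r !norm2N.
  by apply.
exists (2 / d) => x.
have [x0|x0] := eqVneq (norm2 x) 0.
  by rewrite x0 (norm2_eq0 x0) (linop0 lT) norm2_0 mulr0.
have xp : 0 < norm2 x by rewrite lt_neqAle eq_sym x0 norm2_ge0.
have tp : 0 < d / 2 / norm2 x by rewrite !divr_gt0.
have hT : d / 2 / norm2 x * norm2 (T x) < 1.
  have := h ((d / 2 / norm2 x)%:C *: x).
  rewrite (linopZ lT) !norm2Z normc_real gtr0_norm//; apply.
  by rewrite divfK// ltr_pdivrMr// ltr_pMr// ltr1n.
rewrite -(ler_pM2l tp); apply: (le_trans (ltW hT)).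
rewrite le_eqVlt; apply/orP; left; apply/eqP; field.
by rewrite x0 gt_eqF.
Qed.

(** The default 0 of [insubd] makes this total for arbitrary [a]; it is never reached when [a] is
    bounded, by [diagE]. *)
Definition diag (a : nat -> C) : H -> H := fun x => insubd 0 (fun k => a k * x k).

Section Diag.
Variables (a : nat -> C) (B : R).
Hypothesis aB : forall k, normc (a k) <= B.

Let B0 : 0 <= B. Proof. exact: le_trans (normc_ge0 _) (aB 0). Qed.

Let diag_sum x N : \sum_(0 <= i < N) normc (a i * x i) ^+ 2 <= (B * norm2 x) ^+ 2.
Proof.
apply: (@le_trans _ _ (\sum_(0 <= i < N) B ^+ 2 * normc (x i) ^+ 2)).
  apply: ler_sum => i _; rewrite Normc.normcM exprMn ler_wpM2r ?sqr_ge0//.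
  by rewrite ler_pXn2r ?nnegrE ?normc_ge0.
by rewrite -mulr_sumr exprMn ler_wpM2l ?sqr_ge0// sumsq_le.
Qed.

Lemma diagE x k : diag a x k = a k * x k.
Proof. by rewrite /diag /insubd insubT ?(ell2_mem (diag_sum x)). Qed.

Lemma norm2_diag x : norm2 (diag a x) <= B * norm2 x.
Proof.
apply: norm2_le; first by rewrite mulr_ge0 ?norm2_ge0.
by move=> N; under eq_bigr do rewrite diagE; exact: diag_sum.
Qed.

Lemma blin_diag : blin (diag a).
Proof.
split; last by exists B; exact: norm2_diag.
move=> c x y; apply: ell2_ext => k.
by rewrite ell2D ell2Z !diagE ell2D ell2Z mulrDr mulrCA.
Qed.

End Diag.

Lemma inner_diag a B x y : (forall k, normc (a k) <= B) ->
  inner (diag a x) y = inner x (diag (fun k => conjc (a k)) y).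
Proof.
move=> aB; have aB' k : normc (conjc (a k)) <= B by rewrite normc_conj.
apply: (cvgC_unique (@inner_cvg R _ _)).
rewrite (_ : (fun N => _) = fun N => normc (\sum_(0 <= i < N) x i *
  conjc (diag (fun k => conjc (a k)) y i) - inner x (diag (fun k => conjc (a k)) y))).
  exact: inner_cvg.
apply/funext => N; congr (normc (_ - _)); apply: eq_bigr => i _.
by rewrite (diagE aB) (diagE aB') rmorphM /= conjcK mulrCA mulrA.
Qed.

End BoundedOperators.

(** * Singular value systems and the Schatten norm *)

Section SingularValues.
Context {R : realType}.
Local Notation C := R[i].
Local Notation normc := (@Normc.normc R).
Local Notation H := (ell2 R).
Implicit Types (x y z : H) (c : C) (T S : H -> H) (u : nat -> H) (l : nat -> R).

Lemma cvg_Re (z : nat -> C) (w : C) :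
  normc (z n - w) @[n --> \oo] --> (0 : R) ->
  complex.Re (z n) @[n --> \oo] --> complex.Re w.
Proof.
move=> /cvgrPdist_lt h; apply/cvgrPdist_lt => e /h; apply: filterS => n.
rewrite sub0r normrN ger0_norm ?normc_ge0//; apply: le_lt_trans.
rewrite normc_distC; apply: le_trans (normc_Re _).
by case: (z n) => a b; case: (w) => a0 b0.
Qed.

(** Zero vectors are allowed so that finite systems can be indexed by all naturals. The square norm
    of [u k] then acts as a 0/1 indicator in the formulas below. *)
Definition orthosys u := (forall k j, k != j -> inner (u k) (u j) = 0) /\
  forall k, norm2 (u k) = 1 \/ u k = 0.

Section OrthoSystem.
Variable u : nat -> H.
Hypothesis ou : orthosys u.

Lemma orthosys_sqr k x : inner x (u k) * (norm2 (u k) ^+ 2)%:C = inner x (u k).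
Proof.
have [_ /(_ k)[->|->]] := ou; first by rewrite expr1n mulr1.
by rewrite inner0r mul0r.
Qed.

Lemma orthosys_sum_inner (a : nat -> C) N k : (k < N)%N ->
  inner (\sum_(0 <= i < N) a i *: u i) (u k) = a k * (norm2 (u k) ^+ 2)%:C.
Proof.
move=> kN; rewrite inner_suml (bigD1_seq k) ?mem_index_iota ?iota_uniq//=.
rewrite innerZl inner_norm big1 ?addr0// => i ik.
by rewrite innerZl ou.1 ?mulr0.
Qed.

Lemma bessel x N : \sum_(0 <= i < N) normc (inner x (u i)) ^+ 2 <= norm2 x ^+ 2.
Proof.
set s := \sum_(0 <= i < N) _; pose w := \sum_(0 <= i < N) inner x (u i) *: u i.
have xw : inner x w = s%:C.
  rewrite /w inner_sumr /s (rmorph_sum (real_complex R)) /=; apply: eq_bigr => i _.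
  by rewrite innerZr mulrC mulc_conj.
have ww : norm2 w ^+ 2 = s.
  have /(congr1 (@complex.Re R)) /= <- := inner_norm w.
  suff -> : inner w w = inner x w by rewrite xw.
  rewrite {2 3}/w !inner_sumr !big_nat; apply: eq_bigr => i /= iN.
  by rewrite !innerZr orthosys_sum_inner// orthosys_sqr.
have := sqr_ge0 (norm2 (x - w)).
rewrite sqr_norm2D norm2N ww innerNr xw /=; lra.
Qed.

Definition coef (v : nat -> H) x : H := insubd 0 (fun k => inner x (v k)).

Lemma coefE x k : coef u x k = inner x (u k).
Proof. by rewrite /coef /insubd insubT ?(ell2_mem (bessel x)). Qed.

Lemma norm2_coef x : norm2 (coef u x) <= norm2 x.
Proof.
apply: norm2_le; first exact: norm2_ge0.
by move=> N; under eq_bigr do rewrite coefE; exact: bessel.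
Qed.

Lemma blin_coef : blin (coef u).
Proof.
split; last by exists 1 => x; rewrite mul1r norm2_coef.
move=> c x y; apply: ell2_ext => k.
by rewrite ell2D ell2Z !coefE innerDl innerZl.
Qed.

Definition synth (v : nat -> H) : H -> H := adjoint (coef v).

Lemma blin_synth : blin (synth u).
Proof. exact: (adjointP blin_coef).1. Qed.

Lemma inner_synth x y : inner x (synth u y) = inner (coef u x) y.
Proof. by rewrite (adjointP blin_coef).2. Qed.

Lemma inner_synthl x y : inner (synth u x) y = inner x (coef u y).
Proof. by rewrite innerC inner_synth -innerC. Qed.

Lemma synth_basis k : synth u (basis_vec k) = u k.
Proof. by apply: inner_ext => x; rewrite inner_synth inner_basisr coefE. Qed.

Lemma coef_synth y k : inner (synth u y) (u k) = (norm2 (u k) ^+ 2)%:C * y k.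
Proof.
rewrite inner_synthl (_ : coef u (u k) = (norm2 (u k) ^+ 2)%:C *: basis_vec k).
  by rewrite innerZr inner_basisr conjc_real.
apply: ell2_ext => j; rewrite coefE ell2Z basis_vecE.
have [->|jk] := eqVneq j k; first by rewrite inner_norm mulr1.
by rewrite ou.1 1?eq_sym// mulr0.
Qed.

Lemma coef_synth_coef x k : inner (synth u (coef u x)) (u k) = inner x (u k).
Proof. by rewrite coef_synth coefE mulrC orthosys_sqr. Qed.

Lemma coef_residual x : coef u (x - synth u (coef u x)) = 0.
Proof.
by apply: ell2_ext => k; rewrite coefE innerBl coef_synth_coef subrr.
Qed.

End OrthoSystem.

(* [u] collects right singular vectors of [T], padded with zeros, and [l] the
   squares of the singular values. *)
Definition svd T u l := [/\ orthosys u, forall k, 0 <= l k,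
  forall k, u k = 0 -> l k = 0,
  forall k y, inner (T (u k)) (T y) = (l k)%:C * inner (u k) y &
  forall x, (forall k, inner x (u k) = 0) -> T x = 0].

Lemma svd_bound T u l (B : R) : svd T u l -> 0 <= B ->
  (forall x, norm2 (T x) <= B * norm2 x) -> forall k, l k <= B ^+ 2.
Proof.
move=> [[_ u1] l0 ul Tu _] B0 TB k.
have [uk|/ul ->] := u1 k; last exact: sqr_ge0.
have := TB (u k); rewrite uk mulr1 -(@ler_pXn2r _ 2) ?nnegrE ?norm2_ge0//.
apply: le_trans.
have /(congr1 (@complex.Re R)) := Tu k (u k).
by rewrite !inner_norm uk expr1n mulr1 /= => ->.
Qed.

(** As a quadratic form [T^* T] is [S = V^* D V], with [V] the contraction [coef u] and [D] bounded
    by [B]. To see this, replace [y] by its projection [V^* V y]: the difference is orthogonal to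
    every [u k], hence killed by [T]. *)
Lemma svd_le T u l (B : R) x : blin T -> svd T u l -> (forall k, l k <= B) ->
  norm2 (T x) ^+ 2 <= B * norm2 x ^+ 2.
Proof.
move=> bT [ou l0 ul Tu Tk] lB; have lT := blin_linear bT.
have B0 : 0 <= B by exact: le_trans (l0 0%N) (lB 0%N).
have lB' k : normc (l k)%:C <= B by rewrite normc_real ger0_norm.
pose S := synth u \o diag (fun k => (l k)%:C) \o coef u.
have TS y : inner (T y) (T x) = inner y (S x).
  pose y1 := synth u (coef u y).
  have -> : T y = T y1.
    apply/eqP; rewrite -subr_eq0 -(linopB lT); apply/eqP/Tk => k.
    by rewrite innerBl coef_synth_coef// subrr.
  have [A bA AA] := adjoint_exists bT.
  rewrite AA /y1 inner_synthl// /S /= inner_synth//; congr inner.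
  apply: ell2_ext => k; rewrite coefE// (diagE lB') coefE//.
  by rewrite innerC -AA Tu conj_realM -innerC.
have : norm2 (T x) ^+ 2 = complex.Re (inner x (S x)).
  by rewrite -TS inner_norm.
rewrite /S /= inner_synth// => ->.
apply: le_trans (ler_norm _) _; apply: le_trans (normc_Re _) _.
apply: le_trans (cauchy_schwarz _ _) _.
have h1 := norm2_coef ou x; have h2 := norm2_diag lB' (coef u x).
rewrite expr2 mulrCA; apply: ler_pM; rewrite ?norm2_ge0//.
by apply: le_trans h2 _; rewrite ler_wpM2l.
Qed.

Definition spectral_power u l (r : R) : H -> H :=
  synth u \o diag (fun k => (l k `^ r)%:C) \o coef u.

Section Power.
Variables (T : H -> H) (u : nat -> H) (l : nat -> R) (r : R).
Hypotheses (bT : blin T) (sT : svd T u l) (r0 : 0 < r).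

Let P := adjoint T \o T.

Let inner_P x y : inner x (P y) = inner (T x) (T y).
Proof. by rewrite -(adjointP bT).2. Qed.

Let Q := spectral_power u l r.

Lemma svd_power_bound : exists B : R, forall k, normc (l k `^ r)%:C <= B.
Proof.
have [c c0 cT] := blin_bound bT; have lc := svd_bound sT (ltW c0) cT.
have [_ l0 _ _ _] := sT.
exists ((c ^+ 2) `^ r) => k; rewrite normc_real ger0_norm ?powR_ge0//.
by apply: ge0_ler_powR; rewrite ?nnegrE ?(ltW r0) ?sqr_ge0.
Qed.

Let bQ : blin Q.
Proof.
have [ou _ _ _ _] := sT; have [B lB] := svd_power_bound.
by apply: blin_comp (blin_coef ou); apply: blin_comp (blin_synth ou) (blin_diag lB).
Qed.

Let P_basis k : P (u k) = (l k)%:C *: u k.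
Proof.
have [_ _ _ Tu _] := sT; apply: inner_ext => z.
by rewrite inner_P innerZr conjc_real innerC Tu conj_realM -innerC.
Qed.

(** Comparing coefficients of [P v] along [u k] shows that [l k = lambda] wherever the coefficient
    of [v] is nonzero, so the diagonal part acts on the coefficients as one scalar. It remains to
    see that [v] equals its projection onto the singular vectors. *)
Let Q_eigen (lambda : R) v : 0 <= lambda -> P v = lambda%:C *: v ->
  Q v = (lambda `^ r)%:C *: v.
Proof.
have [ou l0 ul Tu Tk] := sT; have [B lB] := svd_power_bound.
move=> lam0 Pv.
have Tv y : inner (T y) (T v) = lambda%:C * inner y v.
  by rewrite -inner_P Pv innerZr conjc_real.
have vk k : (l k)%:C * inner v (u k) = lambda%:C * inner v (u k).
  have := Tv (u k); rewrite Tu => /(congr1 conjc).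
  by rewrite !conj_realM -!innerC.
have -> : Q v = (lambda `^ r)%:C *: synth u (coef u v).
  rewrite /Q /spectral_power /= -(linopZ (blin_linear (blin_synth ou))).
  congr synth; apply: ell2_ext => k; rewrite (diagE lB) ell2Z coefE//.
  have [->|nz] := eqVneq (inner v (u k)) 0; first by rewrite !mulr0.
  by have := mulIf nz (vk k) => -[->].
(* For [lambda = 0] the vector may leave the span, but [0 ^ r = 0] because [r > 0]. Otherwise the
   residual [w] lies in the kernel of [T], and an eigenvector of nonzero eigenvalue is orthogonal to
   that kernel. *)
have [->|lamn0] := eqVneq lambda 0; first by rewrite powR0 ?gt_eqF// !scale0r.
congr (_ *: _); apply/eqP; rewrite eq_sym -subr_eq0; apply/eqP.
set w := v - _; have cw : coef u w = 0 by exact: coef_residual.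
have Tw : T w = 0 by apply: Tk => k; rewrite -coefE// cw.
apply: inner_self0; rewrite {2}/w innerBr inner_synth// cw inner0l subr0.
have := Tv w; rewrite Tw inner0l => /esym/eqP; rewrite mulf_eq0 => /orP[|/eqP//].
by move=> /eqP[] l00; rewrite l00 eqxx in lamn0.
Qed.

(** Existence is [Q_eigen]. For uniqueness, a competitor agrees with [Q] on each [u k], hence on the
    range of [synth u], and on the residual, which is an eigenvector for 0. *)
Lemma operator_power_svd : operator_power P r = Q.
Proof.
have [ou l0 ul Tu Tk] := sT.
have cQ : [/\ linear Q, continuous Q & forall (lambda : R) v, 0 <= lambda ->
    P v = lambda%:C *: v -> Q v = (lambda `^ r)%:C *: v].
  by have [lQ cQ] := blin_continuous bQ; split.
rewrite /operator_power; case: xgetP => [Q' _ [lQ' cQ' eQ']|/(_ Q)//].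
have bQ' := continuous_blin lQ' cQ'.
have bV := blin_synth ou.
have QV : Q' \o synth u = Q \o synth u.
  apply: blin_ext; [exact: blin_comp|exact: blin_comp|] => n /=.
  by rewrite synth_basis// (eQ' _ _ (l0 n) (P_basis n)) (Q_eigen (l0 n) (P_basis n)).
apply/funext => x; pose w := x - synth u (coef u x).
have cw : coef u w = 0 by exact: coef_residual.
have Tw : T w = 0 by apply: Tk => k; rewrite -coefE// cw.
have Pw : P w = 0%:C *: w by rewrite scale0r /P /= Tw (linop0 (blin_linear (adjointP bT).1)).
have -> : x = synth u (coef u x) + w by rewrite /w addrC subrK.
rewrite (linopD lQ') (linopD (blin_linear bQ)).
rewrite (eQ' 0 w)// (Q_eigen (lexx 0) Pw); congr (_ + _).
exact: (congr1 (fun f => f (coef u x)) QV).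
Qed.

(** The trace is a double series of nonnegative terms [l k ^ r * |u k n|^2]. Summing over [n] first
    gives [|u k|^2], which is 1 unless [u k = 0], and then [l k] vanishes too. *)
Lemma trace_svd : trace (operator_power P r) = (\sum_(0 <= k <oo) (l k `^ r)%:E)%E.
Proof.
have [ou l0 ul Tu Tk] := sT; have [B lB] := svd_power_bound.
rewrite operator_power_svd /trace.
have e n : (complex.Re (inner (Q (basis_vec n)) (basis_vec n)))%:E =
    (\sum_(0 <= k <oo) (l k `^ r * normc (u k n) ^+ 2)%:E)%E.
  rewrite /Q /spectral_power /= inner_synthl//; set b := coef u _.
  have := @inner_cvg R (diag (fun k => (l k `^ r)%:C) b) b => /cvg_Re.
  rewrite (_ : (fun N => _) = fun N => \sum_(0 <= k < N) l k `^ r * normc (u k n) ^+ 2).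
    move=> h; apply/esym/cvg_lim => //.
    rewrite (_ : (fun N => _) = EFin \o (fun N => \sum_(0 <= k < N) l k `^ r * normc (u k n) ^+ 2)).
      by apply: cvg_EFin => //; exact: nearW.
    by apply/funext => N /=; rewrite sumEFin.
  apply/funext => N; rewrite Re_sum; apply: eq_bigr => k _.
  rewrite (diagE lB) -mulrA mulc_conj /b coefE// inner_basisl normc_conj.
  by rewrite -realCM.
under eq_eseriesr do rewrite e.
rewrite nneseries_interchange; last first.
  by move=> *; rewrite lee_fin mulr_ge0 ?powR_ge0 ?sqr_ge0.
apply: eq_eseriesr => k _.
under eq_eseriesr do rewrite EFinM.
rewrite nneseriesZl; last by move=> *; rewrite lee_fin sqr_ge0.
rewrite ell2_nneseries -EFinM; congr EFin.
have [_ /(_ k)[->|uk]] := ou; first by rewrite expr1n mulr1.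
by rewrite (ul _ uk) powR0 ?gt_eqF// mul0r.
Qed.

End Power.

Lemma schatten_norm_svd T u l (p : R) : blin T -> svd T u l -> 0 < p ->
  schatten_norm p%:E T = ((\sum_(0 <= k <oo) (l k `^ (p / 2))%:E) `^ p^-1)%E.
Proof.
by move=> bT sT p0; rewrite /schatten_norm (trace_svd bT sT)// divr_gt0.
Qed.

End SingularValues.

(** * Compact operators *)

Section CompactOperators.
Context {R : realType}.
Local Notation C := R[i].
Local Notation normc := (@Normc.normc R).
Local Notation H := (ell2 R).
Implicit Types (x y z : H) (c : C) (T S : H -> H).

(** A cluster point phrased with indices, so that later compactness arguments need no
    subsequences. *)
Lemma precompact_cluster (A : set H) (s : nat -> H) : precompact A ->
  (forall n, A (s n)) ->
  exists y, forall (e : R) N, 0 < e -> exists2 n, (N <= n)%N & norm2 (y - s n) < e.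
Proof.
rewrite precompactE => cA As.
have Fs : (s @ \oo) (closure A) by exists 0%N => // n _; apply: subset_closure; exact: As.
have [y [_ cy]] := cA (s @ \oo) _ Fs.
exists y => e N e0.
have [||z [/= [n Nn <-] h]] := cy [set s n | n in [set n | (N <= n)%N]] [set z | norm2 (y - z) < e].
- by exists N => // n /= Nn; exists n.
- by apply/ell2_nbhsP; exists e.
- by exists n.
Qed.

Lemma ball_norm2 : [set x : H | `|x| <= 1] = [set x | norm2 x <= 1].
Proof. by apply/seteqP; split => x /=; rewrite norm2_normE -lecR. Qed.

Lemma compact_operatorE T : compact_operator T =
  (linear T /\ precompact (T @` [set x | norm2 x <= 1])).
Proof. by rewrite /compact_operator ball_norm2. Qed.

Lemma compact_blin T : compact_operator T -> blin T.
Proof.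
rewrite compact_operatorE => -[lT pT]; split=> //; apply: contrapT => nb.
have h n : exists x, norm2 x <= 1 /\ n%:R < norm2 (T x).
  apply: contrapT => nx; apply: nb; exists n%:R => x.
  have [x0|x0] := eqVneq (norm2 x) 0.
    by rewrite x0 (norm2_eq0 x0) (linop0 lT) norm2_0 mulr0.
  have xp : 0 < norm2 x by rewrite lt_neqAle eq_sym x0 norm2_ge0.
  rewrite leNgt; apply/negP => xT; apply: nx; exists ((norm2 x)^-1%:C *: x).
  rewrite (linopZ lT) !norm2Z normc_real gtr0_norm ?invr_gt0//.
  by rewrite mulVf// ltr_pdivlMl// mulrC.
have /choice[s hs] := h.
have [|y hy] := precompact_cluster (s := T \o s) pT.
  by move=> n; exists (s n) => //; exact: (hs n).1.
(* The threshold exceeds [norm2 y + 1], whereas an image within distance 1 of [y] has norm below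
   that. *)
have [n Nn yn] := hy 1 (Num.truncn (norm2 y + 1)).+1 ltr01.
have := (hs n).2; apply/negP; rewrite -leNgt.
apply: (@le_trans _ _ (norm2 y + norm2 (y - T (s n)))).
  by rewrite norm2_distC -{1}(subrK y (T (s n))) addrC; exact: norm2D.
apply: (@le_trans _ _ (norm2 y + 1)); first by rewrite lerD2l ltW.
apply/ltW; apply: lt_le_trans (truncnS_gt _) _.
by rewrite ler_nat.
Qed.

Lemma compact_comp_contraction T S : compact_operator T -> linear S ->
  (forall x, norm2 (S x) <= norm2 x) -> compact_operator (T \o S).
Proof.
rewrite !compact_operatorE => -[lT pT] lS S1; split.
  by move=> a x y /=; rewrite lS lT.
apply: precompact_subset pT => _ [x /= x1 <-]; exists (S x) => //=.
exact: le_trans (S1 x) x1.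
Qed.

Lemma compact_hausdorff_precompact (A B : set H) :
  compact B -> A `<=` B -> precompact A.
Proof.
move=> cB AB; apply: precompact_subset AB _; exact: compact_precompact (@norm_hausdorff _ H) cB.
Qed.

Lemma compact_blin_comp T S : compact_operator T -> blin S ->
  compact_operator (S \o T).
Proof.
rewrite !compact_operatorE => -[lT pT] bS; have [lS cS] := blin_continuous bS.
split; first by move=> a x y /=; rewrite lT lS.
move: pT; rewrite precompactE => cT.
have cST := continuous_compact (continuous_subspaceT cS) cT.
apply: (compact_hausdorff_precompact cST) => _ [x x1 <-].
by exists (T x) => //; apply: subset_closure; exists x.
Qed.

Definition rank1 (a b : H) : H -> H := fun x => inner x a *: b.

Lemma blin_rank1 a b : blin (rank1 a b).
Proof.
split=> [c x y|]; first by rewrite /rank1 innerDl innerZl scalerDl scalerA.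
exists (norm2 a * norm2 b) => x; rewrite /rank1 norm2Z mulrAC ler_wpM2r ?norm2_ge0//.
by rewrite mulrC; exact: cauchy_schwarz.
Qed.

(** Serves compactness of rank one operators: the image of the unit ball lies in the image of a
    square of [R * R], which is compact as a product of segments. *)
Lemma continuous_scale_complex b :
  continuous (fun z : R * R => (z.1 +i* z.2) *: b : H).
Proof.
move=> z P /ell2_nbhsP [e e0 eP].
pose d := e / 2 / (norm2 b + 1).
have b1 : 0 < norm2 b + 1 by rewrite ltr_wpDl ?norm2_ge0.
have d0 : 0 < d by rewrite !divr_gt0.
exists (ball z.1 d, ball z.2 d) => /=; first by split; exact: nbhsx_ballx.
move=> [s t] /= [zs zt]; apply: eP; rewrite -scalerBl norm2Z.
apply: (@le_lt_trans _ _ ((`|z.1 - s| + `|z.2 - t|) * norm2 b)).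
  rewrite ler_wpM2r ?norm2_ge0//; exact: (normc_le ((z.1 - s) +i* (z.2 - t))).
apply: (@le_lt_trans _ _ ((`|z.1 - s| + `|z.2 - t|) * (norm2 b + 1))).
  by rewrite ler_wpM2l ?addr_ge0// lerDl.
by rewrite -ltr_pdivlMr// [ltRHS](_ : _ = d + d) ?ltrD// /d; field; rewrite gt_eqF.
Qed.

Lemma compact_rank1 a b : compact_operator (rank1 a b).
Proof.
rewrite compact_operatorE; split; first exact: blin_linear (blin_rank1 a b).
pose K := `[- norm2 a, norm2 a]%classic.
have cK : compact (K `*` K) by apply: compact_setX; exact: segment_compact.
have := continuous_compact (continuous_subspaceT (@continuous_scale_complex b)) cK.
move/compact_hausdorff_precompact; apply => _ [x x1 <-].
have xa : normc (inner x a) <= norm2 a.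
  by apply: le_trans (cauchy_schwarz _ _) _; rewrite ler_piMl ?norm2_ge0.
exists (complex.Re (inner x a), complex.Im (inner x a)).
  split; rewrite /K /= in_itv /= -ler_norml.
    exact: le_trans (normc_Re _) xa.
  exact: le_trans (normc_Im _) xa.
by rewrite /rank1 /=; case: (inner x a).
Qed.

Lemma norm2_adjoint T S (B : R) x : 0 <= B -> (forall x, norm2 (T x) <= B * norm2 x) ->
  is_adjoint T S -> norm2 (S x) <= B * norm2 x.
Proof.
move=> B0 TB TS.
have [z0|z0] := eqVneq (norm2 (S x)) 0; first by rewrite z0 mulr_ge0 ?norm2_ge0.
have zp : 0 < norm2 (S x) by rewrite lt_neqAle eq_sym z0 norm2_ge0.
rewrite -(ler_pM2l zp) -expr2.
have -> : norm2 (S x) ^+ 2 = normc (inner (T (S x)) x).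
  by rewrite TS inner_norm normc_real ger0_norm ?sqr_ge0.
apply: le_trans (cauchy_schwarz _ _) _.
by rewrite mulrA (mulrC _ B) ler_wpM2r ?norm2_ge0.
Qed.

(** Expand the square and use [|T^* T x| <= B |T x|]. A unit vector at which [T] almost reaches the
    bound [B] is thus almost an eigenvector of [T^* T] for [B^2]. *)
Lemma almost_eigen T S (B : R) x : 0 <= B -> (forall x, norm2 (T x) <= B * norm2 x) ->
  is_adjoint T S -> norm2 x <= 1 ->
  norm2 (S (T x) - (B ^+ 2)%:C *: x) ^+ 2 <= B ^+ 4 - B ^+ 2 * norm2 (T x) ^+ 2.
Proof.
move=> B0 TB TS x1.
rewrite sqr_norm2D norm2N norm2Z normc_real ger0_norm ?sqr_ge0//.
rewrite innerNr innerZr conjc_real innerC -TS inner_norm conjc_real -realCM -realCN /=.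
have h1 : norm2 (S (T x)) ^+ 2 <= B ^+ 2 * norm2 (T x) ^+ 2.
  rewrite -exprMn ler_pXn2r ?nnegrE ?norm2_ge0 ?mulr_ge0 ?norm2_ge0//.
  exact: norm2_adjoint TS.
have h2 : (B ^+ 2 * norm2 x) ^+ 2 <= B ^+ 4.
  rewrite exprMn -exprM ler_piMr ?exprn_ge0//.
  by rewrite expr_le1 ?norm2_ge0.
move: h1 h2; set a := norm2 (T x) ^+ 2; lra.
Qed.

(** The last clause is the equation [T^* T u = |T u|^2 u] in weak form, free of [adjoint]. For
    linear [T], the value [u = 0] is compatible with the second clause only when [T = 0]. *)
Definition top_vector T u := [/\ u = 0 \/ (norm2 u = 1 /\ 0 < norm2 (T u)),
  forall x, norm2 (T x) <= norm2 (T u) * norm2 x &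
  forall y, inner (T u) (T y) = (norm2 (T u) ^+ 2)%:C * inner u y].

(** Let [s] be the norm and [v n] a maximizing sequence whose images cluster at [y]. By
    [almost_eigen], [s^2 v n] is close to [T^* T v n], hence to [T^* y] along the cluster; so
    [u = s^-2 T^* y] is a limit point of maximizing vectors. *)
Lemma norm_attained T : compact_operator T -> exists u, [/\ norm2 u <= 1,
  (T = (fun=> 0)) \/ (norm2 u = 1 /\ 0 < norm2 (T u)) &
  forall x, norm2 (T x) <= norm2 (T u) * norm2 x].
Proof.
move=> cT; have bT := compact_blin cT; have lT := blin_linear bT.
have [c c0 cTx] := blin_bound bT.
pose E := [set norm2 (T x) | x in [set x | norm2 x <= 1]].
have E0 : E 0 by exists 0; rewrite /= ?norm2_0// (linop0 lT) norm2_0.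
have hE : has_sup E.
  split; first by exists 0.
  exists c => _ [x /= x1 <-]; apply: le_trans (cTx x) _.
  by rewrite ler_piMr// ltW.
pose s := sup E.
have s0 : 0 <= s by exact: sup_upper_bound.
have sT x : norm2 (T x) <= s * norm2 x.
  have [x0|x0] := eqVneq (norm2 x) 0.
    by rewrite x0 (norm2_eq0 x0) (linop0 lT) norm2_0 mulr0.
  have xp : 0 < norm2 x by rewrite lt_neqAle eq_sym x0 norm2_ge0.
  rewrite -ler_pdivrMr// mulrC; apply: sup_upper_bound => //.
  exists ((norm2 x)^-1%:C *: x).
    by rewrite /= norm2Z normc_real gtr0_norm ?invr_gt0// mulVf.
  by rewrite (linopZ lT) norm2Z normc_real gtr0_norm ?invr_gt0.
have [s00|sn0] := eqVneq s 0.
  exists 0; split; rewrite ?norm2_0//.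
    left; apply/funext => x; apply: norm2_eq0; apply/eqP.
    by rewrite eq_le norm2_ge0 andbT; have := sT x; rewrite s00 mul0r.
  by move=> x; have := sT x; rewrite s00 mul0r (linop0 lT) norm2_0 mul0r.
have sp : 0 < s by rewrite lt_neqAle eq_sym sn0.
have /choice[v hv] : forall n, exists x, norm2 x <= 1 /\ s - n.+1%:R^-1 < norm2 (T x).
  move=> n; have [|_ [x /= x1 <-] h] := @sup_adherent _ E n.+1%:R^-1 _ hE.
    by rewrite invr_gt0 ltr0n.
  by exists x.
have [||y hy] := precompact_cluster (A := T @` [set x | norm2 x <= 1]) (s := T \o v).
- by move: cT; rewrite compact_operatorE => -[].
- by move=> n; exists (v n) => //; exact: (hv n).1.
have near_y (e : R) : 0 < e -> exists x, [/\ norm2 x <= 1, s - e < norm2 (T x) & norm2 (y - T x) < e].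
  move=> e0; have [n Nn yn] := hy e (Num.truncn e^-1) e0.
  have [v1 vs] := hv n; exists (v n); split=> //.
  apply: le_lt_trans vs; rewrite lerD2l lerN2 invf_ple ?posrE ?ltr0n//.
  by apply/ltW; apply: lt_le_trans (truncnS_gt _) _; rewrite ler_nat.
have [A bA TA] := adjoint_exists bT.
pose u := (s ^- 2)%:C *: A y.
have lA := blin_linear bA.
have near_u (d : R) : 0 < d -> exists x, [/\ norm2 x <= 1, s - d < norm2 (T x) & norm2 (u - x) <= d].
  move=> d0; pose h := s ^+ 2 * d / 2.
  have h0 : 0 < h by rewrite divr_gt0// mulr_gt0// exprn_gt0.
  (* The distance [s^2 |u - x|] is split into [|A (y - T x)| <= s e] and an eigenvector defect whose
     square is at most [2 s^3 e]. The last two bounds on [e] make each part at most [h], and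
     [2 h = s^2 d]. *)
  pose e := Num.min d (Num.min (h / s) (h ^+ 2 / (2 * s ^+ 3))).
  have e0 : 0 < e by rewrite !lt_min d0 !divr_gt0 ?mulr_gt0 ?exprn_gt0.
  have ed : e <= d by rewrite ge_min lexx.
  have es : s * e <= h by rewrite -ler_pdivlMl// mulrC !ge_min lexx !orbT.
  have eh : 2 * s ^+ 3 * e <= h ^+ 2.
    by rewrite -ler_pdivlMl ?mulr_gt0 ?exprn_gt0// mulrC !ge_min lexx !orbT.
  have [x [x1 xs xy]] := near_y e e0.
  exists x; split=> //; first by apply: le_lt_trans xs; rewrite lerD2l lerN2.
  have s2 : 0 < s ^+ 2 by rewrite exprn_gt0.
  rewrite -(ler_pM2l s2).
  have -> : s ^+ 2 * norm2 (u - x) = norm2 (A (y - T x) + (A (T x) - (s ^+ 2)%:C *: x)).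
    rewrite (linopB lA) addrA subrK.
    rewrite -[X in X * _](ger0_norm (ltW s2)) -normc_real -norm2Z scalerBr /u scalerA.
    by rewrite -realCM mulfV ?gt_eqF// scale1r.
  apply: le_trans (norm2D _ _) _.
  have -> : s ^+ 2 * d = h + h by rewrite /h; field.
  apply: lerD.
    apply: le_trans (norm2_adjoint _ s0 sT TA) _.
    by apply: le_trans es; rewrite ler_pM2l// ltW.
  rewrite -(@ler_pXn2r _ 2) ?nnegrE ?norm2_ge0 ?(ltW h0)//.
  apply: le_trans (almost_eigen s0 sT TA x1) _.
  apply: le_trans eh.
  have [se|se] := leP e s.
    have : (s - e) ^+ 2 <= norm2 (T x) ^+ 2.
      by rewrite ler_pXn2r ?nnegrE ?norm2_ge0 ?subr_ge0// ltW.
    rewrite -(ler_pM2l s2) => h3.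
    apply: (@le_trans _ _ (s ^+ 4 - s ^+ 2 * (s - e) ^+ 2)); first by rewrite lerD2l lerN2.
    rewrite -subr_ge0 (_ : _ - _ = (s * e) ^+ 2) ?sqr_ge0//; ring.
  (* When [e] exceeds [s], squaring [s - e] is of no use, but then [s^4] alone is already below
     [2 s^3 e]. *)
  apply: (@le_trans _ _ (s ^+ 4)); first by rewrite gerBl mulr_ge0 ?sqr_ge0.
  have s3 : 0 < s ^+ 3 by rewrite exprn_gt0.
  rewrite exprSr -mulrA mulrCA ler_pM2l//; lra.
have u1 : norm2 u <= 1.
  apply/ler_addgt0Pr => d d0; have [x [x1 _ ux]] := near_u d d0.
  by rewrite -(subrK x u) addrC (le_trans (norm2D _ _))// lerD.
have uT : s <= norm2 (T u).
  apply/ler_addgt0Pr => d d0.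
  have d1 : 0 < d / (1 + s) by rewrite divr_gt0// ltr_wpDr.
  have [x [x1 xs ux]] := near_u _ d1.
  have : norm2 (T x) <= norm2 (T u) + s * (d / (1 + s)).
    rewrite -{1}(subrK u x) (linopD lT) addrC (le_trans (norm2D _ _))// lerD2l.
    by rewrite (le_trans (sT _))// norm2_distC ler_pM2l.
  have : d / (1 + s) + s * (d / (1 + s)) = d by field; rewrite gt_eqF// ltr_wpDr.
  move: xs; lra.
have us : norm2 (T u) = s.
  apply/eqP; rewrite eq_le uT andbT; apply: le_trans (sT u) _.
  by rewrite ler_piMr.
exists u; rewrite us; split=> //; right; split=> //.
apply/eqP; rewrite eq_le u1 /= -(ler_pM2l sp) mulr1 -{1}us; exact: sT.
Qed.

(** At a vector where the norm is attained, the bound of [almost_eigen] with [B = |T u|] is zero, so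
    the approximate eigenvector is exact. *)
Lemma top_vector_exists T : compact_operator T -> exists u, top_vector T u.
Proof.
move=> cT; have bT := compact_blin cT; have lT := blin_linear bT.
have [u [u1 + uT]] := norm_attained cT; case=> [T0|[u11 Tu0]].
  exists 0; rewrite /top_vector T0 norm2_0 inner0l; split; first by left.
    by move=> x; rewrite mul0r.
  by move=> y; rewrite inner0l mulr0.
exists u; split=> //; first by right.
have [A bA TA] := adjoint_exists bT.
have := almost_eigen (norm2_ge0 _) uT TA u1.
have -> : norm2 (T u) ^+ 4 - norm2 (T u) ^+ 2 * norm2 (T u) ^+ 2 = 0 by ring.
move=> h y.
have /eqP : norm2 (A (T u) - (norm2 (T u) ^+ 2)%:C *: u) ^+ 2 = 0.
  by apply/eqP; rewrite eq_le h sqr_ge0.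
rewrite sqrf_eq0 => /eqP/norm2_eq0/eqP; rewrite subr_eq0 => /eqP Au.
by rewrite innerC TA Au innerZr conjc_real conj_realM -innerC.
Qed.

(** * Deflation and existence of singular value systems *)

Definition deflate (u : H) T : H -> H := fun x => T (x - inner x u *: u).

Definition top_vec T : H := xget 0 [set u | top_vector T u].

Definition deflate_seq T n : H -> H := iter n (fun S => deflate (top_vec S) S) T.

Definition right_vec T n : H := top_vec (deflate_seq T n).

Definition sing_sqr T n : R := norm2 (deflate_seq T n (right_vec T n)) ^+ 2.

Lemma top_vecP T : compact_operator T -> top_vector T (top_vec T).
Proof.
by move=> /top_vector_exists[u Tu]; rewrite /top_vec; case: xgetP => [v _|/(_ u)].
Qed.

Lemma compact_defl T : compact_operator T -> compact_operator (deflate (top_vec T) T).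
Proof.
move=> cT; have [u1 _ _] := top_vecP cT; set u := top_vec T in u1 *.
apply: (@compact_comp_contraction T (fun x => x - inner x u *: u)) => //.
  by move=> a x y; rewrite innerDl innerZl scalerDl -scalerA scalerBr opprD addrACA.
move=> x; case: u1 => [->|[u1 _]]; first by rewrite scaler0 subr0.
rewrite -(@ler_pXn2r _ 2) ?nnegrE ?norm2_ge0// sqr_norm2D norm2N norm2Z u1 mulr1.
rewrite innerNr innerZr (mulrC (conjc _)) mulc_conj /=; have := sqr_ge0 (normc (inner x u)); lra.
Qed.

Lemma compact_defl_seq T n : compact_operator T -> compact_operator (deflate_seq T n).
Proof. by move=> cT; elim: n => //= n; exact: compact_defl. Qed.

Lemma deflate_seqD T n m : deflate_seq (deflate_seq T n) m = deflate_seq T (m + n).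
Proof. by rewrite /deflate_seq iterD. Qed.

Lemma right_vecD T n m : right_vec (deflate_seq T n) m = right_vec T (m + n).
Proof. by rewrite /right_vec deflate_seqD. Qed.

(** Makes the norm of a deflated operator the tail of the series for [T], which is what
    [schatten_tail] exploits. *)
Lemma sing_sqrD T n m : sing_sqr (deflate_seq T n) m = sing_sqr T (m + n).
Proof. by rewrite /sing_sqr right_vecD deflate_seqD. Qed.

Lemma deflate_seqS T n x : compact_operator T ->
  deflate_seq T n.+1 x = deflate_seq T n x - inner x (right_vec T n) *: deflate_seq T n (right_vec T n).
Proof.
move=> cT; have lT := blin_linear (compact_blin (compact_defl_seq n cT)).
by rewrite {1}/deflate_seq iterS -/(deflate_seq T n) /deflate (linopB lT) (linopZ lT).
Qed.

Section Decomposition.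
Variable T : H -> H.
Hypothesis cT : compact_operator T.
Let Tn := deflate_seq T.
Let u := right_vec T.
Let l := sing_sqr T.

Let topT n : top_vector (Tn n) (u n).
Proof. exact: top_vecP (compact_defl_seq n cT). Qed.

Let linT n : linear (Tn n).
Proof. exact: blin_linear (compact_blin (compact_defl_seq n cT)). Qed.

Let unit_u n : norm2 (u n) = 1 \/ u n = 0.
Proof. by have [[->|[-> _]] _ _] := topT n; [right|left]. Qed.

(** Both claims go by induction together: [T_m] kills the earlier [u j], and then the eigenvector
    equation gives [|T_m u_m|^2 <u_m, u_j> = 0], where the factor is positive unless [u_m = 0]. *)
Let ortho_lt m j : (j < m)%N -> Tn m (u j) = 0 /\ inner (u m) (u j) = 0.
Proof.
elim: m => // m IH; rewrite ltnS => jm.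
have T0 : Tn m.+1 (u j) = 0.
  rewrite /Tn deflate_seqS//; move: jm; rewrite leq_eqVlt => /orP[/eqP ->|/IH [Tj uj]].
    rewrite -/u inner_norm; have [->|->] := unit_u m.
      by rewrite expr1n scale1r subrr.
    by rewrite -/Tn (linop0 (linT m)) scaler0 subr0.
  by rewrite -/Tn Tj innerC uj conjc0 scale0r subr0.
split=> //; have [[->|[_ Tu0]] _ Tu] := topT m.+1; first by rewrite inner0l.
have /eqP := Tu (u j); rewrite T0 inner0r eq_sym mulf_eq0 => /orP[|/eqP//].
by move=> /eqP[] /eqP; rewrite sqrf_eq0 gt_eqF.
Qed.

Let ortho_u : orthosys u.
Proof.
split=> // k j; rewrite neq_ltn => /orP[kj|jk].
  by rewrite innerC (ortho_lt kj).2 conjc0.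
exact: (ortho_lt jk).2.
Qed.

(** The equation is known for the level at which [u_k] is the top vector, and is carried down to
    [T_n] one level at a time. Going down adds a multiple of [T_n u_n], which is orthogonal to
    [T_n u_k] because [u_n] is an eigenvector orthogonal to [u_k]. Only [n = 0] is used afterwards,
    but the induction needs all levels. *)
Let gram m : forall n y,
  inner (Tn n (u (m + n)%N)) (Tn n y) = (l (m + n)%N)%:C * inner (u (m + n)%N) y.
Proof.
elim: m => [n y|m IH n y]; first by have [_ _ ->] := topT n.
rewrite addSnnS; set k := (m + n.+1)%N.
have kn : (n < k)%N by rewrite /k addnS ltnS leq_addl.
have [_ ukn] := ortho_lt kn.
have e x : Tn n x = Tn n.+1 x + inner x (u n) *: Tn n (u n).
  by rewrite /Tn [in RHS]deflate_seqS// subrK.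
have Tk : Tn n (u k) = Tn n.+1 (u k) by rewrite e ukn scale0r addr0.
rewrite [in X in inner _ X]e innerDr innerZr Tk IH -/k -Tk.
have [_ _ Tu] := topT n.
by rewrite [inner (Tn n (u k)) _]innerC Tu conj_realM -(innerC (u n) (u k)) ukn !mulr0 addr0.
Qed.

(** Otherwise the vectors [T (u k)], which are pairwise orthogonal, would have norm at least [d]
    from [n] on and lie at squared distance at least [2 d^2]; yet two of them come within [d / 2] of
    one cluster point. *)
Let sing_small n (d : R) : 0 < d -> exists2 k, (n <= k)%N & norm2 (Tn k (u k)) < d.
Proof.
move=> d0; apply: contrapT => nk.
have big k : (n <= k)%N -> d <= norm2 (Tn k (u k)).
  by move=> nk'; rewrite leNgt; apply/negP => kd; apply: nk; exists k.
have pT : precompact (T @` [set x | norm2 x <= 1]).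
  by move: cT; rewrite compact_operatorE => -[].
have Tu k j : inner (T (u k)) (T (u j)) = (l k)%:C * inner (u k) (u j).
  by have := gram k 0 (u j); rewrite addn0.
have [|y hy] := precompact_cluster (s := T \o u) pT.
  move=> k; exists (u k) => //=; have [->|->] := unit_u k => //.
  by rewrite norm2_0 ler01.
have d2 : 0 < d / 2 by rewrite divr_gt0.
have [k nk' yk] := hy _ n d2; have [j kj yj] := hy _ k.+1 d2.
have nj : (n <= j)%N by rewrite (leq_trans nk')// ltnW.
have : norm2 (T (u k) - T (u j)) < d.
  rewrite (_ : _ - _ = - (y - T (u k)) + (y - T (u j))).
    apply: le_lt_trans (norm2D _ _) _; rewrite norm2N.
    by rewrite [ltRHS]splitr ltrD.
  by rewrite opprB addrA subrK.
rewrite -(@ltr_pXn2r _ 2) ?nnegrE ?norm2_ge0 ?(ltW d0)//.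
apply/negP; rewrite -leNgt.
rewrite sqr_norm2D norm2N innerNr Tu.
have -> : inner (u k) (u j) = 0 by rewrite innerC (ortho_lt kj).2 conjc0.
rewrite mulr0 oppr0 /= mulr0 addr0.
have Tk i : (n <= i)%N -> d ^+ 2 <= norm2 (T (u i)) ^+ 2.
  move=> ni; have := Tu i i; rewrite !inner_norm => /(congr1 (@complex.Re R)).
  rewrite -realCM /= => ->.
  have [_ Ti _] := topT i.
  have := big i ni; have [->|->] := unit_u i.
    by move=> di; rewrite expr1n mulr1 ler_pXn2r ?nnegrE ?norm2_ge0 ?(ltW d0).
  by rewrite (linop0 (linT i)) norm2_0 leNgt d0.
by have := Tk k nk'; have := Tk j nj; have := sqr_ge0 d; lra.
Qed.

Lemma svd_exists : svd T u l.
Proof.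
split; [exact: ortho_u|by move=> k; exact: sqr_ge0| | |].
- move=> k uk; rewrite /l /sing_sqr -/u -/Tn.
  by rewrite uk (linop0 (linT k)) norm2_0 expr0n.
- by move=> k y; have := gram k 0 y; rewrite addn0.
(* A vector orthogonal to all [u k] is untouched by deflation, so [|T x|] is bounded by the norm of
   each [T_k] times [|x|], and these norms become arbitrarily small. *)
- move=> x xu; have Tx n : T x = Tn n x.
    elim: n => // n IH.
    by rewrite /Tn deflate_seqS// -/u xu scale0r subr0.
  apply: norm2_eq0; apply/eqP; rewrite eq_le norm2_ge0 andbT.
  apply/ler_addgt0Pr => e e0; rewrite add0r.
  have x1 : 0 < norm2 x + 1 by rewrite ltr_wpDl ?norm2_ge0.
  have [|k _ kd] := @sing_small 0 (e / (norm2 x + 1)); first by rewrite divr_gt0.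
  rewrite (Tx k); have [_ Tk _] := topT k; apply: le_trans (Tk x) _.
  apply: (@le_trans _ _ (e / (norm2 x + 1) * (norm2 x + 1))); last by rewrite divfK// gt_eqF.
  by apply: ler_pM; rewrite ?norm2_ge0// ?(ltW kd)// lerDl.
Qed.

End Decomposition.

End CompactOperators.

(** * Norm estimates *)

Section SchattenNorms.
Context {R : realType}.
Local Notation C := R[i].
Local Notation normc := (@Normc.normc R).
Local Notation H := (ell2 R).
Implicit Types (x y z : H) (c : C) (T S : H -> H) (u : nat -> H) (l : nat -> R).

Lemma nneseries_le_term (f : nat -> R) k : (forall n, 0 <= f n) ->
  ((f k)%:E <= \sum_(0 <= n <oo) (f n)%:E)%E.
Proof.
move=> f0; apply: (@le_trans _ _ (\sum_(0 <= n < k.+1) (f n)%:E)%E).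
  rewrite big_nat_recr//= leeDr// sume_ge0// => n _.
  by rewrite lee_fin.
by apply: nneseries_lim_ge => n _ _; rewrite lee_fin.
Qed.

(** A single term is at most the whole sum, so every singular value is at most [s]; then [svd_le]
    applies. *)
Lemma opnorm_le_schatten T (r s : R) : 0 < r -> compact_operator T ->
  (schatten_norm r%:E T <= s%:E)%E -> forall x, norm2 (T x) <= s * norm2 x.
Proof.
move=> r0 cT; have bT := compact_blin cT; have sT := svd_exists cT.
rewrite (schatten_norm_svd bT sT r0) => Ts x.
have [_ l0 _ _ _] := sT.
have ls k : sing_sqr T k `^ 2^-1 <= s.
  rewrite -lee_fin; apply: le_trans Ts.
  have -> : sing_sqr T k `^ 2^-1 = (sing_sqr T k `^ (r / 2)) `^ r^-1.
    by rewrite -powRrM; congr powR; field; rewrite gt_eqF.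
  rewrite -poweR_EFin; apply: gt0_ler_poweR.
  - by rewrite invr_ge0 ltW.
  - by rewrite in_itv/= leey andbT lee_fin powR_ge0.
  - by rewrite in_itv/= leey andbT nneseries_ge0// => n _ _; rewrite lee_fin powR_ge0.
  - by apply: nneseries_le_term (fun k => sing_sqr T k `^ (r / 2)) _ _ => n; exact: powR_ge0.
have s0 : 0 <= s by exact: le_trans (powR_ge0 _ _) (ls 0%N).
rewrite -(@ler_pXn2r _ 2) ?nnegrE ?norm2_ge0 ?mulr_ge0 ?norm2_ge0//.
rewrite exprMn; apply: svd_le sT _ => // k.
have := ls k; rewrite -(@ler_pXn2r _ 2) ?nnegrE ?powR_ge0//; apply: le_trans.
by rewrite -powR_mulrn ?powR_ge0// -powRrM mulVf ?pnatr_eq0// powRr1.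
Qed.

Lemma nneseries_bound (f : nat -> R) (S : R) : (forall n, 0 <= f n) ->
  (forall N, \sum_(0 <= k < N) f k <= S) -> (\sum_(0 <= k <oo) (f k)%:E <= S%:E)%E.
Proof.
move=> f0 fS; apply: lime_le.
  by apply: is_cvg_nneseries => n _ _; rewrite lee_fin.
by apply: nearW => N; rewrite sumEFin lee_fin.
Qed.

Lemma schatten_norm_le T u l (r S : R) : 0 < r -> blin T -> svd T u l ->
  (forall N, \sum_(0 <= k < N) l k `^ (r / 2) <= S) ->
  (schatten_norm r%:E T <= (S `^ r^-1)%:E)%E.
Proof.
move=> r0 bT sT lS; rewrite (schatten_norm_svd bT sT r0) -poweR_EFin.
have f0 n : 0 <= l n `^ (r / 2) by exact: powR_ge0.
have S0 : 0 <= S by have := lS 0%N; rewrite big_geq.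
apply: gt0_ler_poweR.
- by rewrite invr_ge0 ltW.
- by rewrite in_itv/= leey andbT nneseries_ge0// => n _ _; rewrite lee_fin.
- by rewrite in_itv/= leey andbT lee_fin.
- exact: nneseries_bound.
Qed.

Lemma operator_norm_le T (B : R) : (forall x, norm2 (T x) <= B * norm2 x) -> 0 <= B ->
  (operator_norm T <= B%:E)%E.
Proof.
move=> TB B0; apply: ge_ereal_sup => _ [x /= x1 <-]; rewrite lee_fin.
by apply: le_trans (TB x) _; rewrite ler_piMr.
Qed.

Lemma operator_norm_ge T x : norm2 x <= 1 -> ((norm2 (T x))%:E <= operator_norm T)%E.
Proof. by move=> x1; apply: ereal_sup_ubound; exists x. Qed.

(** * Rank one operators *)

Section RankOne.

Lemma rank1_svd (a b : H) : norm2 a = 1 -> svd (rank1 a b)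
  (fun k => if k == 0%N then a else 0) (fun k => if k == 0%N then norm2 b ^+ 2 else 0).
Proof.
move=> a1; have a0 : a <> 0 by move=> a0; move: a1; rewrite a0 norm2_0 => /eqP; rewrite eq_sym oner_eq0.
split.
- split=> [[|k] [|j]|[|k]] //=; rewrite ?inner0l ?inner0r//; [by left|by right].
- by case=> //= ; exact: sqr_ge0.
- by case.
- case=> [|k] y /=; last by rewrite /rank1 !inner0l scale0r !inner0l mulr0.
  rewrite /rank1 innerZl innerZr !inner_norm a1 expr1n mul1r.
  by rewrite mulrC -innerC.
- by move=> x /(_ 0%N) /= xa; rewrite /rank1 xa scale0r.
Qed.

Let rank1_norm_unit (a b : H) (p : \bar R) : norm2 a = 1 -> (1 <= p)%E ->
  schatten_norm p (rank1 a b) = (norm2 b)%:E.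
Proof.
move=> a1; case: p => [r||] //; rewrite ?lee_fin => r1.
  have r0 : 0 < r by apply: lt_le_trans r1.
  rewrite (schatten_norm_svd (blin_rank1 a b) (rank1_svd b a1) r0).
  rewrite (nneseriesD1 (n := 0)) => [|k _|//]; last by rewrite lee_fin powR_ge0.
  rewrite eseries0 ?adde0 => [|k _ k0]; last first.
    by rewrite (negbTE k0) powR0// gt_eqF// divr_gt0.
  rewrite eqxx poweR_EFin -powR_mulrn ?norm2_ge0// -!powRrM.
  by rewrite (_ : 2 * _ = 1) ?powRr1 ?norm2_ge0//; field; rewrite gt_eqF.
apply/eqP; rewrite eq_le; apply/andP; split.
  apply: operator_norm_le; last exact: norm2_ge0.
  move=> x; rewrite /rank1 norm2Z mulrC ler_wpM2l ?norm2_ge0//.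
  by rewrite -[leRHS]mulr1 -a1; exact: cauchy_schwarz.
have := @operator_norm_ge (rank1 a b) a; rewrite a1 lexx => /(_ isT).
by rewrite /rank1 inner_norm a1 expr1n scale1r.
Qed.

Lemma rank1_norm (a b : H) (p : \bar R) : (1 <= p)%E ->
  schatten_norm p (rank1 a b) = (norm2 a * norm2 b)%:E.
Proof.
move=> p1; have [a0|a0] := eqVneq (norm2 a) 0.
  (* The system of [rank1_svd] needs a unit vector on the right, so the zero operator is rewritten
     with a basis vector there. *)
  rewrite a0 mul0r (norm2_eq0 a0) (_ : rank1 0 b = rank1 (basis_vec 0) 0).
    by rewrite rank1_norm_unit ?norm2_basis// norm2_0.
  by apply/funext => x; rewrite /rank1 inner0r scale0r scaler0.
have ap : 0 < norm2 a by rewrite lt_neqAle eq_sym a0 norm2_ge0.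
rewrite (_ : rank1 a b = rank1 ((norm2 a)^-1%:C *: a) ((norm2 a)%:C *: b)).
  rewrite rank1_norm_unit//.
    by rewrite norm2Z normc_real gtr0_norm.
  by rewrite norm2Z normc_real gtr0_norm ?invr_gt0// mulVf.
apply/funext => x; rewrite /rank1 innerZr conjc_real scalerA mulrAC -realCM.
by rewrite mulVf// mul1r.
Qed.

Lemma schatten_rank1 (a b : H) (p : \bar R) : (1 <= p)%E -> schatten p (rank1 a b).
Proof. by move=> p1; split; [exact: compact_rank1|rewrite rank1_norm// ltry]. Qed.

End RankOne.

(** The left singular vectors [w k] form an orthogonal system inside the span of the first [n] basis
    vectors. Bessel's inequality for each of these basis vectors, summed, shows that at most [n] of
    the [w k] are nonzero, and each contributes at most [B ^ r]. *)
Lemma schatten_norm_finite_range T (r B : R) n : 0 < r -> compact_operator T -> 0 <= B ->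
  (forall x i, (n <= i)%N -> T x i = 0) -> (forall x, norm2 (T x) <= B * norm2 x) ->
  (schatten_norm r%:E T <= (n%:R `^ r^-1 * B)%:E)%E.
Proof.
move=> r0 cT B0 Tn TB; have bT := compact_blin cT; have sT := svd_exists cT.
set u := right_vec T in sT; set l := sing_sqr T in sT.
have [ou l0 ul Tu _] := sT.
have lB := svd_bound sT B0 TB.
(* Since [0^-1 = 0], a vanishing singular value yields [w k = 0], which [orthosys] admits. *)
pose w k := (Num.sqrt (l k))^-1%:C *: T (u k).
have ww k j : inner (w k) (w j) =
    ((Num.sqrt (l k))^-1 * (Num.sqrt (l j))^-1 * l k)%:C * inner (u k) (u j).
  by rewrite /w innerZl innerZr Tu conjc_real !realCM !mulrA.
have wk k : l k != 0 -> norm2 (w k) = 1.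
  move=> lk; have lkp : 0 < l k by rewrite lt_neqAle eq_sym lk l0.
  have uk : norm2 (u k) = 1 by have [//|/ul lk0] := ou.2 k; rewrite lk0 eqxx in lk.
  have := ww k k; rewrite !inner_norm uk expr1n mulr1 => /(congr1 (@complex.Re R)) /=.
  rewrite -invfM -expr2 sqr_sqrtr ?l0// mulVf// => /eqP.
  by rewrite sqrp_eq1 ?norm2_ge0// => /eqP.
have ow : orthosys w.
  split=> [k j kj|k]; first by rewrite ww ou.1// mulr0.
  have [lk|/wk ->] := eqVneq (l k) 0; last by left.
  by right; rewrite /w lk sqrtr0 invr0 scale0r.
have wn k : norm2 (w k) ^+ 2 = \sum_(0 <= i < n) normc (w k i) ^+ 2.
  rewrite -norm2_comb; congr (norm2 _ ^+ 2); apply: ell2_ext => i.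
  by rewrite combE; case: ltnP => // ni; rewrite /w ell2Z Tn// mulr0.
have lw k : l k `^ (r / 2) <= norm2 (w k) ^+ 2 * B `^ r.
  have [lk|lk] := eqVneq (l k) 0.
    by rewrite lk powR0 ?gt_eqF ?divr_gt0// mulr_ge0 ?sqr_ge0 ?powR_ge0.
  rewrite wk// expr1n mul1r; apply: (@le_trans _ _ ((B ^+ 2) `^ (r / 2))).
    by apply: ge0_ler_powR; rewrite ?nnegrE ?sqr_ge0 ?divr_ge0 ?(ltW r0).
  by rewrite -powR_mulrn// -powRrM mulrCA mulfV ?pnatr_eq0// mulr1.
have : (schatten_norm r%:E T <= ((n%:R * B `^ r) `^ r^-1)%:E)%E.
  apply: schatten_norm_le sT _ => // N.
  apply: (@le_trans _ _ (\sum_(0 <= k < N) norm2 (w k) ^+ 2 * B `^ r)).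
    by apply: ler_sum => k _; exact: lw.
  rewrite -mulr_suml ler_wpM2r ?powR_ge0//.
  under eq_bigr do rewrite wn.
  rewrite exchange_big /=.
  apply: (@le_trans _ _ (\sum_(0 <= i < n) 1)); last first.
    by rewrite big_const_nat subn0 iter_addr_0.
  apply: ler_sum => i _.
  have := bessel ow (basis_vec i) N; rewrite norm2_basis expr1n; apply: le_trans.
  by apply: ler_sum => k _; rewrite inner_basisl normc_conj.
by rewrite powRM ?powR_ge0// -powRrM mulfV ?gt_eqF// powRr1.
Qed.

Lemma schatten_finite_range T (r : R) n : 0 < r -> compact_operator T ->
  (forall x i, (n <= i)%N -> T x i = 0) -> schatten r%:E T.
Proof.
move=> r0 cT Tn; split=> //; have [c c0 cTx] := blin_bound (compact_blin cT).
exact: le_lt_trans (schatten_norm_finite_range r0 cT (ltW c0) Tn cTx) (ltry _).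
Qed.

(** * Multiplication by diagonal unitaries *)

Section Unimodular.
Variables (a b : nat -> C).
Hypotheses (a1 : forall k, normc (a k) = 1) (b1 : forall k, normc (b k) = 1).

Let conj1 (d : nat -> C) : (forall k, normc (d k) = 1) -> forall k, normc (conjc (d k)) <= 1.
Proof. by move=> d1 k; rewrite normc_conj d1. Qed.

Let le1 (d : nat -> C) : (forall k, normc (d k) = 1) -> forall k, normc (d k) <= 1.
Proof. by move=> d1 k; rewrite d1. Qed.

Lemma diag_conjK (d : nat -> C) x : (forall k, normc (d k) = 1) ->
  diag (fun k => conjc (d k)) (diag d x) = x.
Proof.
move=> d1; apply: ell2_ext => k.
rewrite (diagE (conj1 d1)) (diagE (le1 d1)) mulrA [_ * d k]mulrC mulc_conj d1 expr1n.
by rewrite mul1r.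
Qed.

Lemma conj_diagK (d : nat -> C) x : (forall k, normc (d k) = 1) ->
  diag d (diag (fun k => conjc (d k)) x) = x.
Proof.
move=> d1; apply: ell2_ext => k.
by rewrite (diagE (le1 d1)) (diagE (conj1 d1)) mulrA mulc_conj d1 expr1n mul1r.
Qed.

Lemma diag_isometry (d : nat -> C) x y : (forall k, normc (d k) = 1) ->
  inner (diag d x) (diag d y) = inner x y.
Proof. by move=> d1; rewrite (inner_diag _ _ (le1 d1)) diag_conjK. Qed.

Lemma blin_udiag (d : nat -> C) : (forall k, normc (d k) = 1) -> blin (diag d).
Proof. by move=> d1; exact: blin_diag (le1 d1). Qed.

Definition dconj T : H -> H := diag a \o T \o diag b.

Lemma compact_dconj T : compact_operator T -> compact_operator (dconj T).
Proof.
move=> cT; apply: compact_comp_contraction.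
- by apply: compact_blin_comp cT (blin_udiag a1).
- exact: blin_linear (blin_udiag b1).
- by move=> x; have := norm2_diag (le1 b1) x; rewrite mul1r.
Qed.

(** The left unitary leaves inner products of images unchanged, and the right one is undone by
    moving the singular vectors with its adjoint. The squared singular values [l] stay the same,
    whence isometry for every exponent. *)
Lemma svd_dconj T u l : svd T u l ->
  svd (dconj T) (fun k => diag (fun k => conjc (b k)) (u k)) l.
Proof.
move=> [[uo u1] l0 ul Tu Tk].
have b1' k : normc (conjc (b k)) = 1 by rewrite normc_conj.
have lb := blin_linear (blin_udiag b1').
split=> //.
- split=> [k j kj|k]; first by rewrite diag_isometry// uo.
  have [uk|->] := u1 k; last by right; exact: linop0.
  left; apply/eqP; rewrite -sqrp_eq1 ?norm2_ge0//; apply/eqP.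
  have := inner_norm (diag (fun k => conjc (b k)) (u k)).
  by rewrite diag_isometry// inner_norm uk expr1n => /(congr1 (@complex.Re R)).
- by move=> k uk; apply: ul; rewrite -(conj_diagK (u k) b1) uk (linop0 (blin_linear (blin_udiag b1))).
- move=> k y; rewrite /dconj /= diag_isometry// conj_diagK// Tu.
  congr (_ * _); rewrite [RHS](inner_diag _ _ (le1 b1')); congr inner.
  by congr diag; apply/funext => i; rewrite conjcK.
- move=> x xu; rewrite /dconj /= Tk ?(linop0 (blin_linear (blin_udiag a1)))// => k.
  by rewrite (inner_diag _ _ (le1 b1)).
Qed.

Lemma schatten_norm_dconj T (r : R) : 0 < r -> compact_operator T ->
  schatten_norm r%:E (dconj T) = schatten_norm r%:E T.
Proof.
move=> r0 cT; have sT := svd_exists cT.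
rewrite (schatten_norm_svd (compact_blin cT) sT r0).
by rewrite (schatten_norm_svd (compact_blin (compact_dconj cT)) (svd_dconj sT) r0).
Qed.

Lemma schatten_dconj T (r : R) : 0 < r -> schatten r%:E T -> schatten r%:E (dconj T).
Proof.
move=> r0 [cT nT]; split; first exact: compact_dconj.
by rewrite schatten_norm_dconj.
Qed.

Lemma matrix_dconj T : blin T -> matrix_of (dconj T) = fun i j => a i * b j * matrix_of T i j.
Proof.
move=> bT; apply/funext => i; apply/funext => j; rewrite /matrix_of /dconj /=.
have -> : diag b (basis_vec j) = b j *: basis_vec j.
  apply: ell2_ext => k; rewrite (diagE (le1 b1)) ell2Z basis_vecE.
  by case: eqVneq => [->|] //; rewrite !mulr0.
by rewrite (linopZ (blin_linear bT)) (diagE (le1 a1)) ell2Z mulrA.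
Qed.

End Unimodular.

Lemma sing_sums_bounded T (r : R) : 0 < r -> compact_operator T ->
  (schatten_norm r%:E T < +oo)%E ->
  exists S : R, forall N, \sum_(0 <= k < N) sing_sqr T k `^ (r / 2) <= S.
Proof.
move=> r0 cT; rewrite (schatten_norm_svd (compact_blin cT) (svd_exists cT) r0).
set f := fun k => sing_sqr T k `^ (r / 2).
have f0 n : 0 <= f n by exact: powR_ge0.
have s0 : (0 <= \sum_(0 <= k <oo) (f k)%:E)%E.
  by apply: nneseries_ge0 => n _ _; rewrite lee_fin.
case E : (\sum_(0 <= k <oo) (f k)%:E)%E s0 => [s| |]// _.
  move=> _; exists s => N; rewrite -lee_fin -E -sumEFin.
  by apply: (@nneseries_lim_ge _ (fun k => (f k)%:E)) => n _ _; rewrite lee_fin.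
by rewrite /poweR invr_eq0 gt_eqF// ltxx.
Qed.

Lemma sum_nat_shift (f : nat -> R) n N :
  \sum_(0 <= k < n + N) f k = \sum_(0 <= k < n) f k + \sum_(0 <= k < N) f (k + n)%N.
Proof.
rewrite (big_cat_nat (n := n)) ?leq_addr//=; congr (_ + _).
by rewrite -{1}[n]add0n big_addn addKn.
Qed.

Lemma schatten_norm_defl_seq_le T (r S : R) n : 0 < r -> compact_operator T ->
  (forall N, \sum_(0 <= k < N) sing_sqr T (k + n)%N `^ (r / 2) <= S) ->
  (schatten_norm r%:E (deflate_seq T n) <= (S `^ r^-1)%:E)%E.
Proof.
move=> r0 cT TS; have cTn := compact_defl_seq n cT.
have TS' N : \sum_(0 <= k < N) sing_sqr (deflate_seq T n) k `^ (r / 2) <= S.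
  by under eq_bigr do rewrite sing_sqrD; exact: TS.
exact: schatten_norm_le r0 (compact_blin cTn) (svd_exists cTn) TS'.
Qed.

Lemma schatten_defl_seq T (r : R) n : 0 < r -> schatten r%:E T ->
  schatten r%:E (deflate_seq T n).
Proof.
move=> r0 [cT nT]; split; first exact: compact_defl_seq.
have [S TS] := sing_sums_bounded r0 cT nT.
apply: (@le_lt_trans _ _ (S `^ r^-1)%:E); last exact: ltry.
apply: (schatten_norm_defl_seq_le r0 cT) => N; apply: le_trans (TS (n + N)%N).
rewrite sum_nat_shift ler_wpDl//.
by apply: sumr_ge0 => i _; exact: powR_ge0.
Qed.

(** By the shift of indices under deflation, the norm to the power [r] is a tail of a convergent
    series, so it suffices to wait until that tail is below [e ^ r]. This replaces density of finite
    rank operators. *)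
Lemma schatten_tail T (r e : R) : 0 < r -> schatten r%:E T -> 0 < e ->
  exists n, (schatten_norm r%:E (deflate_seq T n) <= e%:E)%E.
Proof.
move=> r0 [cT nT] e0; have [S TS] := sing_sums_bounded r0 cT nT.
set f := fun k => sing_sqr T k `^ (r / 2) in TS.
have f0 n : 0 <= f n by exact: powR_ge0.
have cf := cvg_nonneg_series f0 TS.
have er : 0 < e `^ r by exact: powR_gt0.
have /cvgrPdist_le/(_ _ er) [n _ /(_ n (leqnn n)) hn] := cf.
exists n.
have -> : e = (e `^ r) `^ r^-1 by rewrite -powRrM mulfV ?gt_eqF// powRr1 ?ltW.
apply: (schatten_norm_defl_seq_le r0 cT) => N.
have h2 : \sum_(0 <= k < n + N) f k <= limn (series f).
  apply: (nondecreasing_cvgn_le _ cf (n + N)%N).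
  by apply/nondecreasing_series => k _.
apply: le_trans hn; apply: le_trans (ler_norm _).
by rewrite lerBrDl; apply: le_trans h2; rewrite sum_nat_shift.
Qed.

End SchattenNorms.

(** * Isometric multipliers *)

Section IsometricMultipliers.
Context {R : realType}.
Local Notation C := R[i].
Local Notation normc := (@Normc.normc R).
Local Notation H := (ell2 R).
Implicit Types (x y z : H) (c : C) (T S : H -> H).

(** With the companion [powR_gt_self]: applied to two positive numbers of sum 1, this separates the
    sum of their powers from 1 on either side of exponent 1. *)
Lemma powR_lt_self (x q : R) : 0 < x -> x < 1 -> 1 < q -> x `^ q < x.
Proof.
move=> x0 x1 q1; rewrite /powR gt_eqF// -{2}(lnK x0) ltr_expR.
by rewrite gtr_nMl// ln_lt0// x0.
Qed.

Lemma powR_gt_self (x q : R) : 0 < x -> x < 1 -> q < 1 -> x < x `^ q.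
Proof.
move=> x0 x1 q1; rewrite /powR gt_eqF// -{1}(lnK x0) ltr_expR.
by rewrite ltr_nMl// ln_lt0// x0.
Qed.

(* [2 + t] and [2 - t] are the squared singular values of a unimodular 2 x 2 matrix. *)
Lemma powR_sum_eq (t q : R) : 0 <= t -> t <= 2 -> 0 < q -> q != 1 ->
  (2 + t) `^ q + (2 - t) `^ q = 4 `^ q -> t = 2.
Proof.
move=> t0 t2 q0 q1 e; apply/eqP; rewrite eq_le t2 /= leNgt; apply/negP => tl.
pose x := (2 + t) / 4; pose y := (2 - t) / 4.
have x0 : 0 < x by rewrite /x; lra.
have x1 : x < 1 by rewrite /x; lra.
have y0 : 0 < y by rewrite /y; lra.
have y1 : y < 1 by rewrite /y; lra.
have xy : x + y = 1 by rewrite /x /y; field.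
have e' : x `^ q + y `^ q = 1.
  apply: (@mulIf _ (4 `^ q)); first by rewrite gt_eqF// powR_gt0.
  rewrite mul1r mulrDl -!powRM ?(ltW x0) ?(ltW y0)// -e.
  by congr (_ `^ _ + _ `^ _); rewrite divfK ?pnatr_eq0.
have [ql|ql] := ltP q 1.
  have := powR_gt_self x0 x1 ql; have := powR_gt_self y0 y1 ql; lra.
have {}ql : 1 < q by rewrite lt_neqAle eq_sym q1.
have := powR_lt_self x0 x1 ql; have := powR_lt_self y0 y1 ql; lra.
Qed.

Lemma nneseries_two (f : nat -> R) : (forall k, (2 <= k)%N -> f k = 0) ->
  (\sum_(0 <= k <oo) (f k)%:E)%E = (f 0%N + f 1%N)%:E.
Proof.
move=> f0; apply/cvg_lim => //; apply: cvg_near_cst; exists 2 => // N /= N2.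
have z : \sum_(2 <= k < N) f k = 0.
  by rewrite big_nat big1// => k /andP[k2 _]; exact: f0.
by rewrite sumEFin (big_cat_nat (n := 2))//= z addr0 !big_nat_recr//= big_geq// add0r.
Qed.

Lemma matrix_rank1 (a b : H) i j : matrix_of (rank1 a b) i j = conjc (a j) * b i.
Proof. by rewrite /matrix_of /rank1 ell2Z inner_basisl. Qed.

Lemma unimodular_phase c : exists2 d : C, normc d = 1 & d * c = (normc c)%:C.
Proof.
have [->|c0] := eqVneq c 0; first by exists 1; rewrite ?Normc.normc1// mulr0 Normc.normc0.
have n0 : normc c != 0 by rewrite normc_eq0.
have np : 0 < normc c by rewrite lt_neqAle eq_sym n0 normc_ge0.
exists ((normc c)^-1%:C * conjc c).
  by rewrite Normc.normcM normc_real normc_conj gtr0_norm ?invr_gt0// mulVf.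
by rewrite -mulrA (mulrC (conjc c)) mulc_conj -realCM expr2 mulrA mulVf// mul1r.
Qed.

(** * Singular values of an operator with two nonzero columns of equal norm *)

Section TwoColumns.
Variables (j l : nat) (f g : H) (m : R) (d : C).
Hypotheses (jl : j != l) (fm : norm2 f ^+ 2 = m) (gm : norm2 g ^+ 2 = m).
Hypotheses (d1 : normc d = 1) (ds : d * inner g f = (normc (inner g f))%:C).

Let T := rank1 (basis_vec j) f + rank1 (basis_vec l) g.
Let t := normc (inner g f).
Let q : R := (Num.sqrt 2)^-1.
(** The Gram matrix of the columns has diagonal [m] and off-diagonal entries [inner g f] and its
    conjugate. As [d * inner g f] is the modulus [t], the vectors (1, d) and (1, -d), scaled by [q]
    to unit length, are eigenvectors for [m + t] and [m - t]. *)
Let u0 : H := q%:C *: (basis_vec j + d *: basis_vec l).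
Let u1 : H := q%:C *: (basis_vec j - d *: basis_vec l).
Let u k : H := if k == 0%N then u0 else if k == 1%N then u1 else 0.
Let lam k : R := if k == 0%N then m + t else if k == 1%N then m - t else 0.

Let TE x : T x = x j *: f + x l *: g.
Proof. by rewrite /T -[LHS]/(rank1 _ _ x + rank1 _ _ x) /rank1 !inner_basisr. Qed.

Let q2 : q * q * 2 = 1.
Proof. by rewrite -invfM -expr2 sqr_sqrtr// mulVf// pnatr_eq0. Qed.

Let q_neq0 : q != 0. Proof. by rewrite invr_eq0 gt_eqF// sqrtr_gt0. Qed.

Let jl0 : basis_vec j l = 0 :> C. Proof. by rewrite basis_vecE eq_sym (negbTE jl). Qed.
Let lj0 : basis_vec l j = 0 :> C. Proof. by rewrite basis_vecE (negbTE jl). Qed.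
Let jj1 : basis_vec j j = 1 :> C. Proof. by rewrite basis_vecE eqxx. Qed.
Let ll1 : basis_vec l l = 1 :> C. Proof. by rewrite basis_vecE eqxx. Qed.

Let conj_s : conjc (inner g f) = t%:C * d.
Proof.
have dd : d * conjc d = 1 by rewrite mulc_conj d1 expr1n.
rewrite -[LHS]mul1r -dd -mulrA -rmorphM ds mulrC; congr (_ * _).
exact: conjc_real.
Qed.

Let inner_fg : inner f g = t%:C * d.
Proof. by rewrite innerC conj_s. Qed.

Let inner_TT x y : inner (T x) (T y) =
  conjc (y j) * (x j * m%:C + x l * inner g f) + conjc (y l) * (x j * (t%:C * d) + x l * m%:C).
Proof.
rewrite !TE innerDl !innerDr !innerZl !innerZr !inner_norm inner_fg fm gm; ring.
Qed.

Let u0j : u0 j = q%:C. Proof. by rewrite ell2Z ell2D ell2Z jj1 lj0 mulr0 addr0 mulr1. Qed.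
Let u0l : u0 l = q%:C * d. Proof. by rewrite ell2Z ell2D ell2Z jl0 ll1 mulr1 add0r. Qed.
Let u1j : u1 j = q%:C. Proof. by rewrite ell2Z ell2D ell2N ell2Z jj1 lj0 mulr0 subr0 mulr1. Qed.
Let u1l : u1 l = - (q%:C * d).
Proof. by rewrite ell2Z ell2D ell2N ell2Z jl0 ll1 mulr1 add0r mulrN. Qed.

Let inner_u0 y : inner u0 y = q%:C * (conjc (y j) + d * conjc (y l)).
Proof. by rewrite innerZl innerDl innerZl !inner_basisl. Qed.

Let inner_u1 y : inner u1 y = q%:C * (conjc (y j) - d * conjc (y l)).
Proof. by rewrite innerZl innerBl innerZl !inner_basisl. Qed.

Let dd : d * conjc d = 1. Proof. by rewrite mulc_conj d1 expr1n. Qed.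

Let qq : q%:C * q%:C * 2 = 1 :> C.
Proof.
transitivity ((q * q * 2)%:C : C); last by rewrite q2.
by rewrite !realCM; congr (_ * _); exact: esym (realCD 1 1).
Qed.

Let conjcN (z : C) : conjc (- z) = - conjc z. Proof. exact: rmorphN. Qed.

Let conj_q : conjc q%:C = q%:C :> C. Proof. exact: conjc_real. Qed.

Let norm_u0 : norm2 u0 = 1.
Proof.
apply/eqP; rewrite -sqrp_eq1 ?norm2_ge0//; apply/eqP.
suff : inner u0 u0 = 1 by rewrite inner_norm => /(congr1 (@complex.Re R)).
rewrite inner_u0 u0j u0l conj_realM conj_q mulrCA dd mulr1 -qq; ring.
Qed.

Let norm_u1 : norm2 u1 = 1.
Proof.
apply/eqP; rewrite -sqrp_eq1 ?norm2_ge0//; apply/eqP.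
suff : inner u1 u1 = 1 by rewrite inner_norm => /(congr1 (@complex.Re R)).
rewrite inner_u1 u1j u1l conjcN conj_realM conj_q mulrN mulrCA dd mulr1 -qq; ring.
Qed.

Let inner_u0u1 : inner u0 u1 = 0.
Proof.
rewrite inner_u0 u1j u1l conjcN conj_realM conj_q mulrN mulrCA dd mulr1; ring.
Qed.

Lemma two_columns_le : t <= m.
Proof.
rewrite /t; apply: le_trans (cauchy_schwarz _ _) _.
by rewrite (_ : norm2 f = norm2 g) -?expr2 ?gm//;
  apply/eqP; rewrite -(@eqrXn2 _ 2) ?norm2_ge0// fm gm.
Qed.

Let u_ortho : orthosys u.
Proof.
have U2 k : u k.+2 = 0 by [].
split=> [k k'|k].
  case: k => [|[|k]]; last by rewrite U2 inner0l.
    case: k' => [|[|k']] h; [by case/negP: h|exact: inner_u0u1|by rewrite U2 inner0r].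
  case: k' => [|[|k']] h; [|by case/negP: h|by rewrite U2 inner0r].
  by rewrite innerC (inner_u0u1 : inner (u 0%N) (u 1%N) = 0) conjc0.
case: k => [|[|k]]; first by left; exact: norm_u0.
  by left; exact: norm_u1.
by right; exact: U2.
Qed.

Lemma svd_two_columns : svd T u lam.
Proof.
have t0 : 0 <= t by exact: normc_ge0.
have tm := two_columns_le.
have m0 : 0 <= m by exact: le_trans tm.
split; first exact: u_ortho.
- case=> [|[|k]]; rewrite -?[lam 0%N]/(m + t) -?[lam 1%N]/(m - t).
  + exact: addr_ge0.
  + by rewrite subr_ge0.
  + exact: lexx.
- case=> [|[|k]] h.
  + by move: norm_u0; rewrite -[u0]/(u 0%N) h norm2_0 => /eqP; rewrite eq_sym oner_eq0.
  + by move: norm_u1; rewrite -[u1]/(u 1%N) h norm2_0 => /eqP; rewrite eq_sym oner_eq0.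
  + exact: erefl.
- case=> [|[|k]] y; rewrite -?[u 0%N]/u0 -?[u 1%N]/u1 -?[lam 0%N]/(m + t) -?[lam 1%N]/(m - t).
  + rewrite inner_TT u0j u0l inner_u0 realCD.
    have -> : q%:C * d * inner g f = q%:C * t%:C by rewrite -mulrA ds.
    ring.
  + rewrite inner_TT u1j u1l inner_u1 realCD realCN mulNr.
    have -> : q%:C * d * inner g f = q%:C * t%:C by rewrite -mulrA ds.
    ring.
  + by rewrite -[u k.+2]/(0 : H) inner0l TE !ell20 !scale0r addr0 inner0l mulr0.
- move=> x xu; have := xu 0%N; have := xu 1%N; rewrite -[u 0%N]/u0 -[u 1%N]/u1 innerC inner_u1 (innerC u0) inner_u0.
  have qC : q%:C != 0 :> C by apply/eqP => -[q0]; case/eqP: q_neq0.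
  move=> /(congr1 conjc); rewrite conjcK conjc0 => /eqP; rewrite mulf_eq0 (negbTE qC) /= => /eqP e1.
  move=> /(congr1 conjc); rewrite conjcK conjc0 => /eqP; rewrite mulf_eq0 (negbTE qC) /= => /eqP e0.
  have h2 : (2 : C) != 0 by rewrite pnatr_eq0.
  have xj : x j = 0.
    apply/eqP; rewrite -conjc_eq0; apply/eqP; apply: (mulfI h2); rewrite mulr0.
    rewrite -[RHS](addr0 0) -{1}e1 -e0; ring.
  have xl : x l = 0.
    apply/eqP; rewrite -conjc_eq0; apply/eqP; apply: (@mulfI _ d).
      by apply/eqP => d0; move: d1; rewrite d0 Normc.normc0 => /eqP; rewrite eq_sym oner_eq0.
    by move: e1; rewrite xj conjc0 sub0r => /eqP; rewrite oppr_eq0 mulr0 => /eqP.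
  by rewrite TE xj xl !scale0r addr0.
Qed.

Lemma blin_two_columns : blin T.
Proof. by apply: blinD; exact: blin_rank1. Qed.

Lemma two_columns_schatten (r : R) : 0 < r ->
  schatten_norm r%:E T = (((m + t) `^ (r / 2) + (m - t) `^ (r / 2)) `^ r^-1)%:E.
Proof.
move=> r0; rewrite (schatten_norm_svd blin_two_columns svd_two_columns r0).
by rewrite nneseries_two ?poweR_EFin// => -[|[|k]]// _; rewrite powR0// gt_eqF// divr_gt0.
Qed.

(** An upper bound is enough: if the norm is known to be 2 and [m = 2], it yields [4 <= 2 + t]. *)
Lemma two_columns_operator_norm : (operator_norm T <= (Num.sqrt (m + t))%:E)%E.
Proof.
have t0 : 0 <= t by exact: normc_ge0.
have tm := two_columns_le.
apply: operator_norm_le; last exact: sqrtr_ge0.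
move=> x; rewrite -(@ler_pXn2r _ 2) ?nnegrE ?norm2_ge0 ?mulr_ge0 ?sqrtr_ge0 ?norm2_ge0//.
rewrite exprMn sqr_sqrtr ?addr_ge0// ?(le_trans t0)//.
apply: svd_le blin_two_columns svd_two_columns _ => -[|[|k]]; rewrite /lam //=; lra.
Qed.

(* Norm [2] is the largest value allowed by the Hilbert-Schmidt norm, attained only
   when one singular value vanishes. *)
Lemma two_columns_extremal (p : \bar R) : m = 2 -> (1 <= p)%E -> p <> 2%:E ->
  schatten_norm p T = 2%:E -> t = 2.
Proof.
move=> m2 p1 p2; have t0 : 0 <= t by exact: normc_ge0.
have tm := two_columns_le; rewrite m2 in tm.
case: p p1 p2 => [r||]//; rewrite ?lee_fin => r1 r2.
  have r0 : 0 < r by apply: lt_le_trans r1.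
  rewrite two_columns_schatten// m2 => -[] e.
  apply: (@powR_sum_eq _ (r / 2)) => //; first by rewrite divr_gt0.
    apply/eqP => r21; apply: r2; congr EFin.
    by rewrite -(divfK (_ : (2 : R) != 0) r) ?r21 ?mul1r// pnatr_eq0.
  have := congr1 (fun h : R => h `^ r) e.
  rewrite -powRrM mulVf ?gt_eqF// powRr1 ?addr_ge0 ?powR_ge0// => ->.
  rewrite (_ : 4 = 2 `^ 2) -?powRrM.
    by congr powR; field.
  by rewrite powR_mulrn//; ring.
rewrite /= => e; have := two_columns_operator_norm; rewrite e lee_fin m2.
rewrite -(@ler_pXn2r _ 2) ?nnegrE ?sqrtr_ge0// sqr_sqrtr ?addr_ge0//.
move=> h; apply/eqP; rewrite eq_le tm /=; move: h; lra.
Qed.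

End TwoColumns.

(** Equality case of the triangle inequality, through the parallelogram law. *)
Lemma normc_sum_extremal (z w : C) : normc z = 1 -> normc w = 1 -> normc (z + w) = 2 -> z = w.
Proof.
move=> z1 w1 zw; apply/eqP; rewrite -subr_eq0 -normc_eq0 -sqrf_eq0; apply/eqP.
have : normc (z - w) ^+ 2 = 2 * normc z ^+ 2 + 2 * normc w ^+ 2 - normc (z + w) ^+ 2.
  by rewrite !normc_sqr; case: z {z1 zw} => a b; case: w {w1} => a' b' /=; ring.
by rewrite z1 w1 zw => ->; ring.
Qed.

(** * The symbol of an isometric multiplier *)

Section Part1.
Variables (p : \bar R) (A : nat -> nat -> C).
Variable M : set_type (schatten p) -> set_type (schatten p).
Hypotheses (p1 : (1 <= p)%E) (p2 : p <> 2%:E).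
Hypotheses (AM : schur_multiplier p A M) (isoM : isometric p M).

(** Since bounded operators are determined by their matrices, [S] must be the image under [M] of
    [rank1 a b]. This allows explicit images to be tested without unfolding [M]. *)
Let image_rank1 (a b : H) S : blin S ->
  (forall i j, matrix_of S i j = A i j * (conjc (a j) * b i)) ->
  schatten_norm p S = (norm2 a * norm2 b)%:E.
Proof.
move=> bS mS; pose T : set_type (schatten p) :=
  exist _ (rank1 a b) (mem_set (schatten_rank1 a b p1)).
have -> : S = val (M T).
  apply: blin_matrix_ext => //.
    by have [cT _] := set_valP (M T); exact: compact_blin.
  rewrite AM; apply/funext => i; apply/funext => j.
  by rewrite mS /schur matrix_rank1.
by rewrite isoM rank1_norm.
Qed.

Let conj_basis n k : conjc (basis_vec n k : C) = basis_vec n k.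
Proof. by rewrite basis_vecE conjc_nat. Qed.

Lemma isometric_unimodular i j : normc (A i j) = 1.
Proof.
have := image_rank1 (a := basis_vec j) (b := basis_vec i)
  (blin_rank1 (basis_vec j) (A i j *: basis_vec i)).
rewrite rank1_norm// !norm2_basis !mul1r norm2Z norm2_basis mulr1 => h.
suff : (normc (A i j))%:E = 1%:E by case.
apply: h => i' j'; rewrite matrix_rank1 conj_basis ell2Z !basis_vecE.
case: (eqVneq j' j) => [->|_]; last by rewrite !mul0r mulr0.
by case: (eqVneq i' i) => [->|_]; rewrite ?mulr0// !mulr1 mul1r.
Qed.

Let sum2 (z w : C) : normc z = 1 -> normc w = 1 -> normc z ^+ 2 + normc w ^+ 2 = 2 :> R.
Proof. by move=> -> ->; rewrite expr1n. Qed.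

Let norm_pair (i k : nat) (z w : C) : i != k ->
  norm2 (z *: basis_vec i + w *: basis_vec k : H) ^+ 2 = normc z ^+ 2 + normc w ^+ 2.
Proof.
move=> ik; rewrite sqr_norm2D !norm2Z !norm2_basis !mulr1 innerZl innerZr.
rewrite inner_basisl basis_vecE (negbTE ik) conjc0 !mulr0.
by rewrite addr0.
Qed.

Lemma isometric_minor i k j l : i != k -> j != l -> A i j * A k l = A i l * A k j.
Proof.
move=> ik jl.
pose f : H := A i j *: basis_vec i + A k j *: basis_vec k.
pose g : H := A i l *: basis_vec i + A k l *: basis_vec k.
have U := isometric_unimodular.
have fm : norm2 f ^+ 2 = 2 by rewrite norm_pair// sum2.
have gm : norm2 g ^+ 2 = 2 by rewrite norm_pair// sum2.
have [d d1 ds] := unimodular_phase (inner g f).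
(* [rank1 a b] is the block of ones on rows [i], [k] and columns [j], [l]; the columns of its image
   are [f] and [g]. The factors [1 *:] fit the shape of [norm_pair]. *)
pose a : H := 1 *: basis_vec j + 1 *: basis_vec l.
pose b : H := 1 *: basis_vec i + 1 *: basis_vec k.
have n1 : normc (1 : C) = 1 by exact: Normc.normc1.
have ab : norm2 a * norm2 b = 2.
  have : norm2 a ^+ 2 = 2 by rewrite norm_pair// sum2.
  have : norm2 b ^+ 2 = 2 by rewrite norm_pair// sum2.
  have := norm2_ge0 a; have := norm2_ge0 b => b0 a0 b2 a2.
  apply/eqP; rewrite -(@eqrXn2 _ 2) ?mulr_ge0// exprMn a2 b2; apply/eqP; ring.
have nT : schatten_norm p (rank1 (basis_vec j) f + rank1 (basis_vec l) g) = 2%:E.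
  rewrite -ab; apply: image_rank1; first exact: blin_two_columns.
  move=> i' j'; have -> : matrix_of (rank1 (basis_vec j) f + rank1 (basis_vec l) g) i' j' =
    matrix_of (rank1 (basis_vec j) f) i' j' + matrix_of (rank1 (basis_vec l) g) i' j' by [].
  rewrite !matrix_rank1 /f /g /a /b !ell2D !ell2Z !mul1r !basis_vecE !conjc_nat rmorphD /= !conjc_nat.
  case: (eqVneq j' j) => [->|jj]; case: (eqVneq i' i) => [->|ii].
  - by rewrite (negbTE ik) (negbTE jl) /= ?mulr0n ?mulr1n; ring.
  - by rewrite (negbTE jl); case: (eqVneq i' k) => [->|_]; rewrite /= ?mulr0n ?mulr1n; ring.
  - by rewrite (negbTE ik); case: (eqVneq j' l) => [->|_]; rewrite /= ?mulr0n ?mulr1n; ring.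
  - by case: (eqVneq j' l) => [->|_]; case: (eqVneq i' k) => [->|_]; rewrite /= ?mulr0n ?mulr1n; ring.
have := two_columns_extremal jl fm gm d1 ds (erefl _) p1 p2 nT.
have -> : inner g f = A i l * conjc (A i j) + A k l * conjc (A k j).
  rewrite /g innerDl !innerZl !inner_basisl /f !ell2D !ell2Z !basis_vecE.
  rewrite !eqxx (negbTE ik) (eq_sym k i) (negbTE ik) !mulr1 !mulr0 addr0 add0r.
  by [].
have cU i' j' : normc (conjc (A i' j')) = 1 by rewrite normc_conj.
(* [inner g f] is a sum of two unimodular numbers and has modulus 2, so they coincide; clearing the
   conjugates gives the minor. *)
move=> h; have := normc_sum_extremal _ _ h.
rewrite !Normc.normcM !U !cU mulr1 => /(_ erefl erefl) e.
have AA i' j' : A i' j' * conjc (A i' j') = 1 by rewrite mulc_conj U expr1n.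
transitivity (A k l * conjc (A k j) * A k j * A i j).
  by rewrite -(mulrA (A k l)) (mulrC (conjc _)) AA mulr1 mulrC.
by rewrite -e mulrAC -(mulrA (A i l)) (mulrC (conjc _)) AA mulr1.
Qed.

Lemma isometric_rank_one : exists a b : nat -> C,
  (forall i, `|a i| = 1) /\ (forall j, `|b j| = 1) /\ (forall i j, A i j = a i * b j).
Proof.
have U := isometric_unimodular.
have AA : A 0%N 0%N * conjc (A 0%N 0%N) = 1 by rewrite mulc_conj U expr1n.
(* Column 0 and row 0 determine the rest through the minors containing the corner, whose inverse is
   its conjugate. Indices 0 are treated apart because minors need distinct rows and columns. *)
exists (fun i => A i 0%N), (fun j => conjc (A 0%N 0%N) * A 0%N j).
split; first by move=> i; rewrite normE U.
split; first by move=> j; rewrite normE Normc.normcM normc_conj !U mulr1.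
move=> i j; have [->|i0] := eqVneq i 0%N; first by rewrite mulrA AA mul1r.
have [->|j0] := eqVneq j 0%N; first by rewrite [_ * A 0%N 0%N]mulrC AA mulr1.
rewrite mulrCA [A i _ * _]mulrC -(isometric_minor (i := 0%N) (k := i) (j := 0%N) (l := j)) 1?eq_sym//.
  by rewrite mulrA [conjc _ * _]mulrC AA mul1r.
Qed.

End Part1.
End IsometricMultipliers.

(** * The weak operator topology *)

Lemma cvg_initial (S : choiceType) (T : topologicalType) (f : S -> T)
    (F : set_system S) (s : S) : Filter F ->
  f @ F --> f s -> F --> (s : initial_topology f).
Proof.
move=> FF cvF A /= [_ [[B Bop <-] Bfs] sBfA].
by apply: filterS sBfA _; apply: cvF; rewrite nbhsE; exists B.
Qed.

Section WeakOperatorTopology.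
Context {R : realType} (p : \bar R).
Local Notation C := R[i].
Local Notation Sp := (set_type (schatten p)).
Local Notation Idx := (set_type (schatten_dual (p := p)) * Sp)%type.

Lemma wot_eval_continuous (q : Idx) :
  continuous (fun M : wot p => wot_eval M q : C^o).
Proof.
move=> M A MA.
have h1 : nbhs (wot_eval M : {ptws Idx -> C^o}) ((fun f : Idx -> C^o => f q) @^-1` A).
  have /cvg_sup/(_ q) : (wot_eval M : {ptws Idx -> C^o}) --> (wot_eval M : {ptws Idx -> C^o}).
    exact: cvg_id.
  apply.
  exact: (@initial_continuous _ _ (@proj _ (fun=> C^o) q) (wot_eval M) A MA).
exact: (@initial_continuous _ _ (@wot_eval R p) M _ h1).
Qed.

Lemma wot_cvg (s : nat -> wot p) (M : wot p) :
  (forall q : Idx, (fun n => wot_eval (s n) q : C^o) @ \oo --> (wot_eval M q : C^o)) ->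
  s @ \oo --> M.
Proof.
move=> h; apply: cvg_initial; apply/cvg_sup => q.
apply: cvg_initial; exact: h.
Qed.

End WeakOperatorTopology.

(** * The closure of the span of the isometric multipliers *)

Section SchurSpan.
Context {R : realType} (r : R) (r1 : 1 <= r).
Local Notation C := R[i].
Local Notation normc := (@Normc.normc R).
Local Notation H := (ell2 R).
Local Notation p := (r%:E : \bar R).
Local Notation Sp := (set_type (schatten (r%:E : \bar R))).
Local Notation dual := (set_type (schatten_dual (p := (r%:E : \bar R)))).
Implicit Types (x y z : H) (c : C) (T S : H -> H) (X Y : Sp).

Let r0 : 0 < r. Proof. exact: lt_le_trans r1. Qed.
Let p1 : (1 <= p)%E. Proof. by rewrite lee_fin. Qed.

Definition toSp T (h : schatten p T) : Sp := exist _ T (mem_set h).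

Lemma Sp_compact X : compact_operator (val X).
Proof. by have [] := set_valP X. Qed.

Lemma Sp_blin X : blin (val X).
Proof. exact: compact_blin (Sp_compact X). Qed.

Definition Sp_norm X : R := fine (schatten_norm p (val X)).

Lemma Sp_normE X : schatten_norm p (val X) = (Sp_norm X)%:E.
Proof.
rewrite fineK// ge0_fin_numE; first by have [] := set_valP X.
exact: poweR_ge0.
Qed.

Lemma Sp_norm_ge0 X : 0 <= Sp_norm X.
Proof. by rewrite -lee_fin -Sp_normE; exact: poweR_ge0. Qed.

Lemma Sp_opnorm X x : norm2 (val X x) <= Sp_norm X * norm2 x.
Proof.
by apply: (opnorm_le_schatten r0 (Sp_compact X)); rewrite Sp_normE.
Qed.

Lemma entry_dual_subproof i j :
  schatten_dual (fun X : Sp => matrix_of (val X) i j : C^o).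
Proof.
split; first by move=> c S T U /= ->.
exists 1 => T; rewrite Sp_normE mul1e lee_fin; apply: le_trans (coord_le _ _) _.
by apply: le_trans (Sp_opnorm T _) _; rewrite norm2_basis mulr1.
Qed.

Definition entry_dual i j : dual :=
  exist (fun f => f \in schatten_dual (p := p)) _ (mem_set (entry_dual_subproof i j)).

Definition unitSp i j : Sp := toSp (schatten_rank1 (basis_vec j) (basis_vec i) p1).

Lemma matrix_unitSp i j : matrix_of (val (unitSp i j)) i j = 1.
Proof. by rewrite matrix_rank1 !basis_vecE !eqxx conjc1 mulr1. Qed.

Lemma matrix_sum (I : Type) (s : seq I) (c : I -> C) (F : I -> H -> H) i j :
  matrix_of (\sum_(k <- s) c k *: F k) i j = \sum_(k <- s) c k * matrix_of (F k) i j.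
Proof. by apply: (big_morph (fun T => matrix_of T i j)). Qed.

(** The symbol is read off from the image of the matrix unit, so the multiplier property becomes a
    relation between two evaluations of [M], each continuous for the weak operator topology. *)
Lemma span_entry (M : wot p) X i j :
  linear_span p (isometric_schur_multipliers p) M ->
  matrix_of (val (val M X)) i j =
  matrix_of (val X) i j * matrix_of (val (val M (unitSp i j))) i j.
Proof.
move=> [n [c [F [isoF MF]]]].
have /choice[A FA] : forall k, exists A, schur_multiplier p A (val (F k)).
  by move=> k; have [[A FA] _] := isoF k; exists A.
have e Y : matrix_of (val (val M Y)) i j = (\sum_k c k * A k i j) * matrix_of (val Y) i j.
  rewrite MF matrix_sum mulr_suml; apply: eq_bigr => k _.
  by rewrite FA /schur mulrA.
by rewrite !e matrix_unitSp mulr1 mulrC.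
Qed.

Lemma closure_span_sub :
  closure (linear_span p (isometric_schur_multipliers p)) `<=` schur_multipliers p.
Proof.
move=> M cM; exists (fun i j => matrix_of (val (val M (unitSp i j))) i j) => X.
apply/funext => i; apply/funext => j; rewrite /schur mulrC; apply/eqP.
(* A continuous function vanishing on the span by [span_entry]; were it nonzero at [M], some element
   of the span would be closer to [M] in value than 0 is. *)
pose f (N : wot p) : C^o := (wot_eval N (entry_dual i j, X) : C^o)
  - matrix_of (val X) i j *: (wot_eval N (entry_dual i j, unitSp i j) : C^o).
rewrite -subr_eq0 -[X in X == 0]/(f M); apply: contrapT => /negP fM.
have cf : f @ M --> f M.
  have e1 := @wot_eval_continuous R p (entry_dual i j, X) M.
  have e2 := @wot_eval_continuous R p (entry_dual i j, unitSp i j) M.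
  by apply: (cvgB e1); apply: cvgZr; exact: e2.
have fM0 : 0 < `|f M| by rewrite normr_gt0.
move/cvgrPdist_lt : cf => /(_ _ fM0) /cM [N [sN /=]].
have -> : f N = 0 by rewrite /f /wot_eval /= span_entry// subrr.
by rewrite subr0 ltxx.
Qed.

Section UnimodularMultiplier.
Variables (a b : nat -> C).
Hypotheses (a1 : forall k, normc (a k) = 1) (b1 : forall k, normc (b k) = 1).

Definition dconjSp X : Sp := toSp (schatten_dconj a1 b1 r0 (set_valP X)).

Lemma dconj_linear (a' b' : nat -> C) c S T (B : R) : (forall k, normc (a' k) <= B) ->
  dconj a' b' (c *: S + T) = c *: dconj a' b' S + dconj a' b' T.
Proof.
move=> aB; apply/funext => x; rewrite /dconj /=.
exact: (blin_linear (blin_diag aB)).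
Qed.

Lemma dconjSp_norm X : schatten_norm p (val (dconjSp X)) = schatten_norm p (val X).
Proof. by rewrite schatten_norm_dconj//; exact: Sp_compact. Qed.

Lemma dconjSp_bounded : bounded_op dconjSp.
Proof.
split=> [c S T U /= ->|].
  by apply: (@dconj_linear _ _ _ _ _ 1) => k; rewrite a1.
by exists 1 => T; rewrite dconjSp_norm mul1e.
Qed.

Definition dconj_wot : wot p := exist _ dconjSp (mem_set dconjSp_bounded).

Lemma dconj_wot_isometric : isometric_schur_multipliers p dconj_wot.
Proof.
split; last by move=> X; exact: dconjSp_norm.
exists (fun i j => a i * b j) => X /=.
by rewrite matrix_dconj//; exact: Sp_blin.
Qed.

End UnimodularMultiplier.

Lemma diag_add (a a1 a2 : nat -> C) (B : R) x : (forall k, normc (a k) <= B) ->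
  (forall k, normc (a1 k) <= B) -> (forall k, normc (a2 k) <= B) ->
  (forall k, a k = a1 k + a2 k) -> diag a x = diag a1 x + diag a2 x.
Proof.
move=> aB a1B a2B aE; apply: ell2_ext => k.
by rewrite ell2D (diagE aB) (diagE a1B) (diagE a2B) aE mulrDl.
Qed.

Lemma diag_scale (a a1 : nat -> C) c (B : R) x : (forall k, normc (a k) <= B) ->
  (forall k, normc (a1 k) <= B) -> (forall k, a k = c * a1 k) -> diag a x = c *: diag a1 x.
Proof.
move=> aB a1B aE; apply: ell2_ext => k.
by rewrite ell2Z (diagE aB) (diagE a1B) aE mulrA.
Qed.

Definition ind n : nat -> C := fun k => (k < n)%:R.

Lemma ind_le1 n k : normc (ind n k) <= 1.
Proof. by rewrite /ind; case: (k < n)%N; rewrite ?Normc.normc1 ?Normc.normc0. Qed.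

Lemma diag_ind n x : diag (ind n) x = comb x n.
Proof.
apply: ell2_ext => k; rewrite (diagE (ind_le1 n)) combE /ind.
by case: ifP; rewrite ?mul1r ?mul0r.
Qed.

Lemma norm2_ind n x : norm2 (diag (ind n) x) <= norm2 x.
Proof. by have := norm2_diag (ind_le1 n) x; rewrite mul1r. Qed.

(** The bound 2 is chosen to cover twice the projection, needed in [trunc_avg], along with
    unimodular sequences and indicators. *)
Lemma finite_range_dconj (a b : nat -> C) n X : (forall k, normc (a k) <= 2) ->
  (forall k, normc (b k) <= 2) -> (forall k, (n <= k)%N -> a k = 0) ->
  schatten p (dconj a b (val X)).
Proof.
move=> a2 b2 an.
(* Halving the right factor makes it a contraction, as [compact_comp_contraction] requires; the left
   factor is doubled in return, hence the bound 4. *)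
have b2' k : normc (2^-1%:C * b k) <= 1.
  rewrite Normc.normcM normc_real gtr0_norm ?invr_gt0//.
  by rewrite ler_pdivrMl// mulr1.
have a2' k : normc (2%:C * a k) <= 4.
  rewrite Normc.normcM normc_real gtr0_norm//.
  by have := a2 k; lra.
have -> : dconj a b (val X) = diag (fun k => 2%:C * a k) \o val X \o diag (fun k => 2^-1%:C * b k).
  apply/funext => x; apply: ell2_ext => k; rewrite /dconj /= (diagE a2) (diagE a2').
  have -> : diag (fun k => 2^-1%:C * b k) x = 2^-1%:C *: diag b x.
    by apply: ell2_ext => i; rewrite ell2Z (diagE b2') (diagE b2) mulrA.
  rewrite (linopZ (blin_linear (Sp_blin X))) ell2Z.
  by rewrite mulrCA !mulrA -realCM mulVf ?mul1r// pnatr_eq0.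
apply: (@schatten_finite_range _ _ _ n) => //.
  apply: compact_comp_contraction.
  - by apply: compact_blin_comp (Sp_compact X) (blin_diag a2').
  - exact: blin_linear (blin_diag b2').
  - by move=> x; have := norm2_diag b2' x; rewrite mul1r.
by move=> x i ni; rewrite /= (diagE a2') an// mulr0 mul0r.
Qed.

Lemma ind_le2 n k : normc (ind n k) <= 2.
Proof. by apply: le_trans (ind_le1 n k) _; rewrite ler1n. Qed.

Lemma ind_out n k : (n <= k)%N -> ind n k = 0.
Proof. by move=> nk; rewrite /ind ltnNge nk. Qed.

Definition trunc n X : Sp :=
  toSp (finite_range_dconj (n := n) X (ind_le2 n) (ind_le2 n) (@ind_out n)).

Lemma matrix_trunc n X i j :
  matrix_of (val (trunc n X)) i j = ind n i * ind n j * matrix_of (val X) i j.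
Proof.
rewrite /matrix_of /= /dconj /=.
have -> : diag (ind n) (basis_vec j) = ind n j *: basis_vec j.
  apply: ell2_ext => k; rewrite (diagE (ind_le1 n)) ell2Z basis_vecE.
  by case: eqVneq => [->|] //; rewrite !mulr0.
by rewrite (linopZ (blin_linear (Sp_blin X))) (diagE (ind_le1 n)) ell2Z mulrA.
Qed.

(** The factor grows with [n], which is harmless for the boundedness of each single truncation;
    control uniform in [n] comes from [trunc_bound]. *)
Lemma trunc_norm n X :
  (schatten_norm p (val (trunc n X)) <= (n%:R `^ r^-1 * Sp_norm X)%:E)%E.
Proof.
apply: schatten_norm_finite_range => //.
- exact: Sp_compact.
- exact: Sp_norm_ge0.
- by move=> x i ni; rewrite /= /dconj /= (diagE (ind_le1 n)) ind_out// mul0r.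
- move=> x; apply: le_trans (norm2_ind _ _) _; apply: le_trans (Sp_opnorm _ _) _.
  by rewrite ler_wpM2l ?Sp_norm_ge0// norm2_ind.
Qed.

Section TruncatedMultiplier.
Variables (M : wot p) (n : nat).

Definition trunc_mult X : Sp := trunc n (val M X).

Lemma trunc_mult_bounded : bounded_op trunc_mult.
Proof.
have [lM [c cM]] := set_valP M.
split=> [d S T U hU|].
  rewrite /= (lM _ _ _ _ hU).
  exact: (dconj_linear _ _ _ _ (ind_le1 n)).
exists (n%:R `^ r^-1 * c) => T; apply: le_trans (trunc_norm _ _) _.
rewrite EFinM -Sp_normE EFinM -muleA lee_wpmul2l ?lee_fin ?powR_ge0//.
Qed.

Definition trunc_wot : wot p := exist _ trunc_mult (mem_set trunc_mult_bounded).

End TruncatedMultiplier.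

Lemma linear_span_fin (I : finType) (c : I -> C) (F : I -> wot p) (Z : set (wot p)) (M : wot p) :
  (forall k, Z (F k)) ->
  (forall X, val (val M X) = \sum_(k : I) c k *: val (val (F k) X)) ->
  linear_span p Z M.
Proof.
move=> ZF MF; exists #|I|, (fun k => c (enum_val k)), (fun k => F (enum_val k)).
split=> // X; rewrite MF (reindex_onto enum_val enum_rank) => [|k _]; last first.
  exact: enum_rankK.
by apply: eq_bigl => k; rewrite enum_valK eqxx.
Qed.

(** [flip false i] is constantly 1, and half of [flip false i - flip true i] is the indicator of
    [i]. *)
Definition flip (s : bool) (i : nat) : nat -> C := fun k => if s && (k == i) then -1 else 1.

Lemma flip1 s i k : normc (flip s i k) = 1.
Proof. by rewrite /flip; case: ifP; rewrite ?normcN Normc.normc1. Qed.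

Lemma sum_ord_delta n i (f : nat -> C) :
  \sum_(k < n) f k * (i == k :> nat)%:R = ind n i * f i.
Proof.
rewrite /ind; case: ltnP => h.
  rewrite (bigD1 (Ordinal h)) //= eqxx mulr1 mul1r big1 ?addr0// => k.
  by rewrite -val_eqE /= eq_sym => /negbTE ->; rewrite mulr0.
rewrite mul0r big1// => k _.
by rewrite gtn_eqF ?mulr0// (leq_trans (ltn_ord k)).
Qed.

Lemma trunc_wot_span (M : wot p) n : schur_multipliers p M ->
  linear_span p (isometric_schur_multipliers p) (trunc_wot M n).
Proof.
move=> [A AM].
pose I : finType := (('I_n * 'I_n) * (bool * bool))%type.
(* Writing the indicator of an entry as a product of two half differences of [flip] sequences gives
   four terms with these signs and the factor 1/4. *)
pose c (k : I) : C := 4^-1 * A k.1.1 k.1.2 * ((-1) ^+ k.2.1 * (-1) ^+ k.2.2).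
pose F (k : I) := dconj_wot (flip1 k.2.1 k.1.1) (flip1 k.2.2 k.1.2).
apply: (linear_span_fin (I := I) (c := c) (F := F)) => [k|X].
  exact: dconj_wot_isometric.
apply: blin_matrix_ext.
- exact: Sp_blin.
- by apply: blin_sum => k _; apply: blinZ; exact: Sp_blin.
apply/funext => i; apply/funext => j.
rewrite matrix_trunc AM /schur matrix_sum.
set m := matrix_of (val X) i j.
have step (a b : 'I_n) : \sum_(st : bool * bool) c ((a, b), st) * matrix_of (val (val (F ((a, b), st)) X)) i j
    = (A a b * m) * (i == a :> nat)%:R * (j == b :> nat)%:R.
  under eq_bigr do rewrite /= (matrix_dconj (flip1 _ _) (flip1 _ _) (Sp_blin X)) -/m.
  rewrite -(pair_bigA _ (fun s t => c ((a, b), (s, t)) * (flip s a i * flip t b j * m))) /=.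
  rewrite /c !big_bool /flip /= !expr1 !expr0.
  by case: (i == a); case: (j == b); rewrite /= ?mulr0 ?mulr1; field.
rewrite -(pair_bigA _ (fun ab st => c (ab, st) * matrix_of (val (val (F (ab, st)) X)) i j)) /=.
rewrite -(pair_bigA _ (fun a b => \sum_(st : bool * bool) c ((a, b), st) * matrix_of (val (val (F ((a, b), st)) X)) i j)) /=.
under eq_bigr do under eq_bigr do rewrite step.
under eq_bigr => a _ do rewrite (sum_ord_delta n j (fun b => A a b * m * (i == a :> nat)%:R)) mulrA.
rewrite (sum_ord_delta n i (fun a => ind n j * (A a j * m))); ring.
Qed.

(** * Convergence of bounded functionals along truncations *)

Section TruncationConvergence.
Variables (phi : dual) (c : R).
Hypothesis c0 : 0 <= c.
Let f X : C := val phi X.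
Hypothesis fc : forall X, normc (f X) <= c * Sp_norm X.

Let f_lin a X Y (Z : Sp) : val Z = a *: val X + val Y -> f Z = a * f X + f Y.
Proof. by move=> h; have [lf _] := set_valP phi; exact: lf. Qed.

Let fD X Y (Z : Sp) : val Z = val X + val Y -> f Z = f X + f Y.
Proof. by move=> h; rewrite (@f_lin 1 X Y) ?mul1r// scale1r. Qed.

Let one : nat -> C := fun=> 1.
Let sgn n : nat -> C := fun k => if (k < n)%N then 1 else -1.
Let two n : nat -> C := fun k => 2 * ind n k.

Let one1 k : normc (one k) = 1. Proof. exact: Normc.normc1. Qed.
Let sgn1 n k : normc (sgn n k) = 1.
Proof. by rewrite /sgn; case: ifP; rewrite ?normcN Normc.normc1. Qed.

Let normc2 : normc (2 : C) = 2.
Proof. by have := normc_real (2 : R); rewrite ger0_norm// => <-; congr normc; exact: esym (realCD 1 1). Qed.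

Let two2 n k : normc (two n k) <= 2.
Proof. by rewrite Normc.normcM normc2 ler_piMr// ind_le1. Qed.

Let two_out n k : (n <= k)%N -> two n k = 0.
Proof. by move=> nk; rewrite /two ind_out// mulr0. Qed.

Let twoE n k : two n k = one k + sgn n k.
Proof. by rewrite /two /one /sgn /ind; case: (k < n)%N; rewrite /= ?mulr1 ?mulr0; ring. Qed.

Let le2 (d : nat -> C) : (forall k, normc (d k) = 1) -> forall k, normc (d k) <= 2.
Proof. by move=> d1 k; rewrite d1 ler1n. Qed.

(* [4 P X P = X + U X + X U + U X U] for the symmetry [U = 2 P - 1]; the partial sums
   have finite rank, so no triangle inequality in [S_p] is needed. *)
Let trunc_avg n X : 4 * f (trunc n X) =
  f (dconjSp one1 one1 X) + f (dconjSp (sgn1 n) one1 X) +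
  (f (dconjSp one1 (sgn1 n) X) + f (dconjSp (sgn1 n) (sgn1 n) X)).
Proof.
pose Y1 := toSp (finite_range_dconj X (two2 n) (le2 one1) (@two_out n)).
pose Y2 := toSp (finite_range_dconj X (two2 n) (le2 (sgn1 n)) (@two_out n)).
pose Y3 := toSp (finite_range_dconj X (two2 n) (two2 n) (@two_out n)).
have lX := blin_linear (Sp_blin X).
have add x := diag_add x (two2 n) (le2 one1) (le2 (sgn1 n)) (twoE n).
have D (b : nat -> C) : dconj (two n) b (val X) = dconj one b (val X) + dconj (sgn n) b (val X).
  apply/funext => x; exact: (add (val X (diag b x))).
have <- : f Y1 = f (dconjSp one1 one1 X) + f (dconjSp (sgn1 n) one1 X).
  by apply: fD; exact: D.
have <- : f Y2 = f (dconjSp one1 (sgn1 n) X) + f (dconjSp (sgn1 n) (sgn1 n) X).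
  by apply: fD; exact: D.
have <- : f Y3 = f Y1 + f Y2.
  apply: fD; apply/funext => x.
  have e : diag (two n) (val X (diag (two n) x)) =
      diag (two n) (val X (diag one x)) + diag (two n) (val X (diag (sgn n) x)).
    by rewrite (add x) (linopD lX) (linopD (blin_linear (blin_diag (two2 n)))).
  exact: e.
(* Linearity is available only in the form [c *: S + T], so 4 is split as 3 + 1. *)
rewrite (@f_lin 3 (trunc n X) (trunc n X) Y3); first by ring.
apply/funext => x.
have scale y : diag (two n) y = 2 *: diag (ind n) y.
  exact: (diag_scale y (two2 n) (ind_le2 n)).
have e : diag (two n) (val X (diag (two n) x)) =
    3 *: diag (ind n) (val X (diag (ind n) x)) + diag (ind n) (val X (diag (ind n) x)).
  rewrite !scale (linopZ lX) (linopZ (blin_linear (blin_diag (ind_le1 n)))) scalerA.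
  by rewrite -[X in _ = _ + X]scale1r -scalerDl; congr (_ *: _); ring.
exact: e.
Qed.

Let Sp_norm_dconjSp (a b : nat -> C) (a1 : forall k, normc (a k) = 1)
  (b1 : forall k, normc (b k) = 1) X : Sp_norm (dconjSp a1 b1 X) = Sp_norm X.
Proof. by rewrite /Sp_norm dconjSp_norm. Qed.

(** By [trunc_avg] the value is an average of four values of [f] at elements with the same norm as
    [X]; the bound therefore does not depend on [n]. *)
Let trunc_bound n X : normc (f (trunc n X)) <= c * Sp_norm X.
Proof.
have h4 : normc (4 : C) = 4.
  have -> : (4 : C) = 2 * 2 by ring.
  by rewrite Normc.normcM normc2; ring.
rewrite -(@ler_pM2l _ 4)// -[X in X * _ <= _]h4 -Normc.normcM trunc_avg.
have B (a b : nat -> C) (a1 : forall k, normc (a k) = 1) (b1 : forall k, normc (b k) = 1) :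
  normc (f (dconjSp a1 b1 X)) <= c * Sp_norm X.
  by apply: le_trans (fc _) _; rewrite Sp_norm_dconjSp.
apply: le_trans (le_normcD _ _) _.
have -> : 4 * (c * Sp_norm X) = (c * Sp_norm X + c * Sp_norm X) + (c * Sp_norm X + c * Sp_norm X).
  by ring.
by apply: lerD; apply: le_trans (le_normcD _ _) _; apply: lerD; exact: B.
Qed.

Let rank1Sp (a b : H) : Sp := toSp (schatten_rank1 a b p1).

Let Sp_norm_rank1 a b : Sp_norm (rank1Sp a b) = norm2 a * norm2 b.
Proof. by rewrite /Sp_norm rank1_norm. Qed.

(** Truncation replaces [a] and [b] by their sections. Changing one vector at a time makes each
    difference of rank one, with explicitly known norm. *)
Let trunc_rank1 n (a b : H) : normc (f (trunc n (rank1Sp a b)) - f (rank1Sp a b)) <=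
  c * (norm2 (a - comb a n) * norm2 b) + c * (norm2 a * norm2 (b - comb b n)).
Proof.
have e1 : f (rank1Sp a b) = f (rank1Sp (a - comb a n) b) + f (rank1Sp (comb a n) b).
  apply: fD; apply/funext => x.
  rewrite /= -[RHS]/(rank1 _ _ x + rank1 _ _ x) /rank1 -scalerDl -innerDr.
  by rewrite subrK.
have e2 : f (rank1Sp (comb a n) b) = f (rank1Sp (comb a n) (b - comb b n)) + f (trunc n (rank1Sp a b)).
  apply: fD; apply/funext => x.
  have ix : inner (diag (ind n) x) a = inner x (comb a n).
    have ci : (fun k => conjc (ind n k)) = ind n by apply/funext => k; rewrite /ind conjc_nat.
    by rewrite (inner_diag x a (ind_le1 n)) ci (diag_ind n a).
  have e : inner x (comb a n) *: b = inner x (comb a n) *: (b - comb b n) +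
      diag (ind n) (inner (diag (ind n) x) a *: b).
    rewrite (linopZ (blin_linear (blin_diag (ind_le1 n)))) (diag_ind n b) ix.
    by rewrite -scalerDr subrK.
  exact: e.
rewrite normc_distC e1 e2 addrA addrK.
apply: le_trans (le_normcD _ _) _; apply: lerD.
  by apply: le_trans (fc _) _; rewrite Sp_norm_rank1.
apply: le_trans (fc _) _; rewrite Sp_norm_rank1 ler_wpM2l// ler_wpM2r ?norm2_ge0//.
by rewrite -diag_ind norm2_ind.
Qed.

(** An eventual bound in place of a limsup, so that errors can be added along the deflation. *)
Let eventually_close X e := exists N, forall n, (N <= n)%N ->
  normc (f (trunc n X) - f X) <= e.

Let close_norm X : eventually_close X (c * Sp_norm X + c * Sp_norm X).
Proof.
exists 0%N => n _; apply: le_trans (le_normcD _ _) _.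
by rewrite normcN; apply: lerD; [exact: trunc_bound|exact: fc].
Qed.

Let rank1_small (a b : H) (d : R) : 0 < d -> eventually_close (rank1Sp a b) d.
Proof.
move=> d0.
pose g n := c * (norm2 (a - comb a n) * norm2 b) + c * (norm2 a * norm2 (b - comb b n)).
have cg : g @ \oo --> (0 : R).
  have -> : 0 = c * (0 * norm2 b) + c * (norm2 a * 0) by ring.
  apply: cvgD; apply: cvgMr.
    by apply: cvgMl; exact: comb_cvg.
  by apply: cvgMr; exact: comb_cvg.
move/cvgrPdist_lt : cg => /(_ _ d0) [N _ gN]; exists N => n Nn.
apply: le_trans (trunc_rank1 n a b) _.
have := gN n Nn; rewrite /= sub0r normrN => /ltW; apply: le_trans.
exact: ler_norm.
Qed.

Let close_add X Y (a b : H) (e d : R) : val X = val Y + rank1 a b ->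
  eventually_close Y e -> 0 < d -> eventually_close X (e + d).
Proof.
move=> h [N hN] d0; have [N' hN'] := @rank1_small a b d d0.
exists (maxn N N') => n; rewrite geq_max => /andP[Nn Nn'].
have -> : f X = f Y + f (rank1Sp a b) by exact: fD.
have -> : f (trunc n X) = f (trunc n Y) + f (trunc n (rank1Sp a b)).
  apply: fD; rewrite /= h -[rank1 a b]/(val (rank1Sp a b)) -[val Y]scale1r.
  by rewrite (dconj_linear _ _ _ _ (ind_le1 n)) !scale1r.
rewrite opprD addrACA; apply: le_trans (le_normcD _ _) _.
by apply: lerD; [exact: hN|exact: hN'].
Qed.

Let deflateSp X k : Sp := toSp (schatten_defl_seq k r0 (set_valP X)).

Let deflateSpS X k : val (deflateSp X k) = val (deflateSp X k.+1) +
  rank1 (right_vec (val X) k) (deflate_seq (val X) k (right_vec (val X) k)).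
Proof.
apply/funext => x; rewrite -[RHS]/(deflate_seq (val X) k.+1 x + rank1 _ _ x).
by rewrite deflate_seqS ?subrK//; exact: Sp_compact.
Qed.

Let close_defl X k : forall e d, 0 < d -> eventually_close (deflateSp X k) e ->
  eventually_close X (e + d).
Proof.
elim: k => [|k IH] e d d0 ce.
  have -> : X = deflateSp X 0 by exact: val_inj.
  by have [N hN] := ce; exists N => n /hN h; apply: le_trans h _; rewrite lerDl ltW.
have d2 : 0 < d / 2 by rewrite divr_gt0.
(* One half of [d] pays for the rank one piece restored here, the other half for the [k] pieces
   still to come. *)
rewrite [d]splitr addrA; apply: (IH _ _ d2).
exact: close_add (deflateSpS X k) ce d2.
Qed.

Lemma trunc_cvg X : normc (f (trunc n X) - f X) @[n --> \oo] --> (0 : R).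
Proof.
apply/cvgrPdist_le => e e0.
(* The remainder costs [c] times its norm twice, once for itself and once for its truncation; the
   added 1 keeps the divisor positive when [c = 0]. *)
pose e' := e / 2 / (c + c + 1).
have c1 : 0 < c + c + 1 by rewrite ltr_wpDl// addr_ge0.
have e'0 : 0 < e' by rewrite !divr_gt0.
have [k hk] := schatten_tail r0 (set_valP X) e'0.
have hk' : Sp_norm (deflateSp X k) <= e' by rewrite -lee_fin -Sp_normE.
have e2 : 0 < e / 2 by rewrite divr_gt0.
have [N hN] := close_defl e2 (close_norm (deflateSp X k)).
exists N => // n /= Nn; rewrite sub0r normrN ger0_norm ?normc_ge0//.
apply: le_trans (hN n Nn) _; rewrite [leRHS]splitr lerD2r -mulrDl.
apply: (@le_trans _ _ ((c + c + 1) * e')); last by rewrite /e' mulrC divfK// gt_eqF.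
by apply: ler_pM => //; [exact: addr_ge0|exact: Sp_norm_ge0|rewrite lerDl].
Qed.

End TruncationConvergence.

Lemma schur_multipliers_sub_closure :
  schur_multipliers p `<=` closure (linear_span p (isometric_schur_multipliers p)).
Proof.
move=> M sM B MB.
suff /(_ _ MB) [N _ /(_ N (leqnn N)) BN] : (fun n => trunc_wot M n) @ \oo --> M.
  by exists (trunc_wot M N); split => //; exact: trunc_wot_span.
apply: wot_cvg => -[phi X].
have [_ [c fc]] := set_valP phi.
apply: (cvg_normc (fun n => val phi (trunc n (val M X))) (val phi (val M X))).2.
(* The constant in [schatten_dual] carries no sign condition, hence the absolute value. *)
apply: (@trunc_cvg phi `|c|) => // Y.
rewrite -lee_fin; apply: le_trans (fc Y) _.
by rewrite Sp_normE -EFinM lee_fin ler_wpM2r ?Sp_norm_ge0// ler_norm.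
Qed.

End SchurSpan.

Theorem theorem1p2 (R : realType) :
  (forall p : \bar R, (1 <= p)%E -> p <> 2%:E ->
     forall (A : nat -> nat -> R[i])
            (M : set_type (schatten p) -> set_type (schatten p)),
       schur_multiplier p A M -> isometric p M ->
       exists a b : nat -> R[i],
         (forall i, `|a i| = 1) /\ (forall j, `|b j| = 1) /\
         (forall i j, A i j = a i * b j)) /\
  (forall p : \bar R, (1 <= p)%E -> (p < +oo)%E ->
     schur_multipliers p = closure (linear_span p (isometric_schur_multipliers p))).
Proof.
split=> [p p1 p2 A M AM isoM|p p1 poo]; first exact: isometric_rank_one AM isoM.
case: p p1 poo => // r; rewrite lee_fin => r1 _.
apply/seteqP; split; first exact: schur_multipliers_sub_closure.
exact: closure_span_sub.
Qed.
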